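(* Let $A$ be a set of positive integers with $\gcd(A) = 1$, and let $\alpha > 0$ be a real number. Then $d(A) = \alpha$ (that is, the asymptotic density of $A$ exists and equals $\alpha$) if and only if \[ \log p_A(n) \sim c_0\sqrt{\alpha n} \quad\text{as } n\to\infty. \]
   Context: For a set $A$ of positive integers, $A(x)$ denotes the number of elements of $A$ not exceeding $x$. If the limit $d(A) = \lim_{x\to\infty} A(x)/x$ exists, it is called the asymptotic density of $A$. The greatest common divisor of all the elements of $A$ is denoted $\gcd(A)$. The partition function $p_A(n)$ counts the partitions of $n$ with parts in $A$, that is, representations of $n$ as a sum of not necessarily distinct elements of $A$ (any number of summands), where representations differing only in the order of the summands are identified; $p_A(0) = 1$. (Since $\gcd(A)=1$, $p_A(n)\ge 1$ for all sufficiently large $n$.) The constant is $c_0 = \pi\sqrt{2/3}$. The notation $f(n)\sim g(n)$ means $f(n)/g(n)\to 1$. *)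

(* Defs.v *)
From mathcomp Require Import all_boot all_order all_algebra.
From mathcomp Require Import finmap multiset.
From mathcomp Require Import all_classical all_reals all_analysis.
Import Order.TTheory GRing.Theory Num.Theory.
Import numFieldNormedType.Exports.

Set Implicit Arguments.
Unset Strict Implicit.
Unset Printing Implicit Defensive.

Local Open Scope classical_set_scope.
Local Open Scope ring_scope.

Definition elements_upto (R : realType) (A : set nat) (x : R) : set nat :=
  [set k : nat | A k /\ k%:R <= x].

Lemma elements_upto_finite (R : realType) (A : set nat) (x : R) :
  finite_set (elements_upto A x).
Proof.
apply: (@sub_finite_set _ _ `I_(Num.truncn x).+1); last exact: finite_II.
move=> k /= [_ kx]; have x0 : 0 <= x by exact: le_trans kx.
by rewrite ltnS truncn_ge_nat.
Qed.

Definition count_upto (R : realType) (A : set nat) (x : R) : nat :=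
  #|` fset_set (elements_upto A x)|%fset.

Definition has_density (R : realType) (A : set nat) (d : R) : Prop :=
  (count_upto A x)%:R / x @[x --> +oo%R] --> d.

(* Greatest with respect to divisibility. *)
Definition is_gcd (A : set nat) (d : nat) : Prop :=
  (forall k, A k -> (d %| k)%N) /\
  (forall e : nat, (forall k, A k -> (e %| k)%N) -> (e %| d)%N).

(* Both the membership and the sum range over the elements of the multiset,
   the sum with multiplicity. *)
Definition partitions (A : set nat) (n : nat) : set (multiset nat) :=
  [set m : multiset nat |
    (forall k : nat, k \in m -> A k) /\ (\sum_(k <- m) k)%N = n].

Lemma partitions_finite (A : set nat) (n : nat) :
  (forall k : nat, A k -> (0 < k)%N) -> finite_set (partitions A n).
Proof.
move=> A0.
pose e (f : {ffun 'I_n.+1 -> 'I_n.+1}) : multiset nat :=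
  [fsfun k in seq_fset tt (iota 0 n.+1) => nat_of_ord (f (inord k))].
apply: (@sub_finite_set _ _ (e @` setT)); last exact: finite_image.
move=> m /= [mA msum].
have bnd k : k \in m -> (m k * k <= n)%N.
  move=> km; rewrite -msum sum_mset (big_fsetD1 k) /= ?leq_addr//.
  by rewrite msuppE.
exists [ffun i : 'I_n.+1 => inord (m i)] => //.
apply/msetP => k; rewrite fsfunE seq_fsetE mem_iota /= add0n ltnS.
have [km|km] := boolP (k \in m); last first.
  have mk0 : m k = 0%N by exact/mset_eq0P.
  by case: ifP => // kn; rewrite ffunE !inordK// mk0.
have := bnd _ km; have k0 := A0 _ (mA _ km).
have m0 : (0 < m k)%N by rewrite -in_mset.
move=> mkn.
have kn : (k <= n)%N by apply: leq_trans mkn; rewrite leq_pmull.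
have mn : (m k <= n)%N by apply: leq_trans mkn; rewrite leq_pmulr.
by rewrite kn ffunE inordK inordK.
Qed.

(* fset_set is the empty set on infinite sets, so this is the number of
   partitions only when A consists of positive integers (partitions_finite). *)
Definition partition_count (A : set nat) (n : nat) : nat :=
  #|` fset_set (partitions A n)|%fset.

Definition c0 (R : realType) : R := pi * Num.sqrt (2 / 3).

(* Only large n matter, so the convention x / 0 = 0 is harmless whenever g is
   eventually nonzero. *)
Definition asymp_equiv (R : realType) (f g : nat -> R) : Prop :=
  f n / g n @[n --> \oo] --> (1 : R).

(* Main.v *)
Require Import Defs.
From HB Require Import structures.
From mathcomp Require Import all_boot all_order all_algebra.
From mathcomp Require Import finmap multiset.
From mathcomp Require Import all_classical all_reals all_analysis.
From mathcomp Require Import ring lra zify.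
Import Order.TTheory GRing.Theory Num.Theory.
Import numFieldNormedType.Exports.

Local Open Scope classical_set_scope.
Local Open Scope ring_scope.

Set Implicit Arguments.
Unset Strict Implicit.
Unset Printing Implicit Defensive.

(** Write [y = exp (-s)] with [s > 0], let [u] be the indicator function of
    [A], and put

      [h s = s * sum_a u a y^a]       ([mean] below),
      [F s = sum_n p_A(n) y^n]        ([laplace] of the partition counts).

    Each of the following conditions is equivalent to the next one, where
    [b = pi^2 / 6 * alpha]; the theorem compares the first with the last,
    since [c0 * sqrt (alpha n) = 2 * sqrt (b n)].

    - [A] has density [alpha];
    - [h s --> alpha] as [s --> 0+];
    - [s * ln (F s) --> b] as [s --> 0+];
    - [ln (p_A(n)) ~ 2 * sqrt (b n)].

    First equivalence: density implies the limit of [h] by Abel summation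
    ([cvg_mean_of_density]). The converse ([density_of_cvg_mean]) is a Tauberian
    theorem for coefficients in [[0, 1]]: the limit of [h] determines that of
    [s * sum_a u a Q(y^a)] for every polynomial [Q] with [Q(0) = 0], and
    [Q(z) = 1 - (1 - z)^M] is a smooth approximation of the indicator function
    of [a <= ln M / s]. Its total error is bounded independently of [M], whereas
    the main term is [alpha * ln M].

    Second equivalence: Euler's product [F s = prod_a (1 - y^a)^-1] over [A]
    gives [s * ln (F s) = sum_k h(k s) / k^2] ([log_gf]). Dominated convergence
    ([tannery]) and [sum_k 1 / k^2 = pi^2 / 6] ([basel]) yield one direction.
    In the other one, the term [k = 1] is [h s] itself, and the remaining weights
    add up to less than 1, so that the error of [h] near 0 contracts
    ([cvg_mean_of_log_mean]).

    Third equivalence: a bound on [p_A(n)] turns into a bound on [F] by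
    maximizing [2 * sqrt (b n) - n s], whose maximum over [n] is [b / s]
    ([cvg_log_laplace_of_growth]). Conversely [p_A(n) y^n <= F s] is the upper
    bound. For the lower bound, [F s] is carried by the [n] near [b / s^2], hence
    one of these [p_A(n)] is large, and [p_A] is nearly monotone: since
    [gcd A = 1], every large [m] has a partition, and adjoining it shows
    [p_A(n) <= p_A(n + m)] ([cvg_growth_of_log_laplace]). *)

(** * Series and dominated convergence *)

Section Series.
Context {R : realType}.
Implicit Types (u v w : nat -> R).

Lemma cvg_series_dominated u v :
  (forall k, `|u k| <= v k) -> cvgn (series v) -> cvgn (series u).
Proof.
move=> uv cv; apply: normed_cvg; apply: series_le_cvg cv => // k; first exact: normr_ge0.
exact: le_trans (normr_ge0 _) (uv k).
Qed.

Lemma norm_lim_series_le u v :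
  (forall k, `|u k| <= v k) -> cvgn (series v) ->
  `|limn (series u)| <= limn (series v).
Proof.
move=> uv cv.
have cu : cvgn [normed series u].
  by apply: series_le_cvg cv => // k; [exact: normr_ge0|exact: le_trans (normr_ge0 _) (uv k)].
by apply: (le_trans (lim_series_norm cu)); exact: lim_series_le.
Qed.

Lemma series_le_lim u n :
  (forall k, 0 <= u k) -> cvgn (series u) -> series u n <= limn (series u).
Proof.
move=> u0 cu; apply: nondecreasing_cvgn_le => //.
exact: nondecreasing_series.
Qed.

Lemma lim_series_ge0 u :
  (forall k, 0 <= u k) -> cvgn (series u) -> 0 <= limn (series u).
Proof. by move=> u0 cu; have := series_le_lim 0 u0 cu; rewrite /series/= big_geq. Qed.

Lemma bounded_series_cvg u M :
  (forall k, 0 <= u k) -> (forall n, series u n <= M) -> cvgn (series u).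
Proof.
move=> u0 uM; apply: nondecreasing_is_cvgn; first exact: nondecreasing_series.
by exists M => _ [n _ <-].
Qed.

Lemma lim_series_le_bound u M :
  (forall n, series u n <= M) -> cvgn (series u) -> limn (series u) <= M.
Proof. by move=> uM cu; apply: limr_le => //; near=> n; exact: uM. Unshelve. all: by end_near. Qed.

(** Linearity in pointwise form: a summand written as an abstraction is not
    syntactically a sum or a multiple of functions. *)
Lemma lim_series_add u v : cvgn (series u) -> cvgn (series v) ->
  limn (series (fun k => u k + v k)) = limn (series u) + limn (series v).
Proof. exact: lim_seriesD. Qed.

Lemma lim_series_sub u v : cvgn (series u) -> cvgn (series v) ->
  limn (series (fun k => u k - v k)) = limn (series u) - limn (series v).
Proof. exact: lim_seriesB. Qed.

Lemma lim_series_scale u c : cvgn (series u) ->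
  limn (series (fun k => c * u k)) = c * limn (series u).
Proof. exact: lim_seriesZ. Qed.

Lemma is_cvg_series_scale u c : cvgn (series u) -> cvgn (series (fun k => c * u k)).
Proof. exact: is_cvg_seriesZ. Qed.

Lemma is_cvg_series_add u v : cvgn (series u) -> cvgn (series v) ->
  cvgn (series (fun k => u k + v k)).
Proof. exact: is_cvg_seriesD. Qed.

Lemma is_cvg_series_sub u v : cvgn (series u) -> cvgn (series v) ->
  cvgn (series (fun k => u k - v k)).
Proof. exact: is_cvg_seriesB. Qed.

Lemma eq_lim_series u v : u =1 v -> limn (series u) = limn (series v).
Proof. by move=> /funext ->. Qed.

Lemma near_forall_ltn (T : Type) (F : set_system T) {FF : Filter F}
    (P : nat -> T -> Prop) K :
  (forall k, \forall t \near F, P k t) ->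
  \forall t \near F, forall k, (k < K)%N -> P k t.
Proof.
move=> FP; elim: K => [|K IH]; first by near=> t.
near=> t => k; rewrite ltnS leq_eqVlt => /predU1P[->|]; first by near: t; exact: FP.
by move: k; near: t; exact: IH.
Unshelve. all: by end_near. Qed.

(** The tail of a summable weight is uniformly small, so only finitely many
    terms have to be close to their limits. *)
Lemma tannery (T : Type) (F : set_system T) {FF : ProperFilter F}
    w (f : T -> nat -> R) (l : nat -> R) (M : R) :
  (forall k, 0 <= w k) -> cvgn (series w) ->
  (\forall t \near F, forall k, `|f t k| <= M) ->
  (forall k, f t k @[t --> F] --> l k) ->
  limn (series (fun k => w k * f t k)) @[t --> F] -->
  limn (series (fun k => w k * l k)).
Proof.
move=> w0 cw fM fl.
have lM k : `|l k| <= M.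
  have fk : `|f t k| @[t --> F] --> `|l k| by apply: cvg_norm; exact: fl.
  rewrite -(cvg_lim _ fk)//; apply: limr_le; first exact: cvgP fk.
  by near=> t; move: k {fk}; near: t; exact: fM.
have M0 : 0 <= M by exact: le_trans (normr_ge0 _) (lM 0%N).
have cwM : cvgn (series (fun k => M * w k)) by exact: is_cvg_series_scale.
pose W := limn (series w).
have W0 : 0 <= W by exact: lim_series_ge0.
apply/cvgrPdist_le => e e0.
pose e1 := e / (2 * (W + 1)); have e10 : 0 < e1 by rewrite divr_gt0// mulr_gt0// ltr_wpDl.
pose e2 := e / (4 * (M + 1)); have e20 : 0 < e2 by rewrite divr_gt0// mulr_gt0// ltr_wpDl.
have [K _ HK] : \forall n \near \oo, `|W - series w n| <= e2.
  by move/cvgrPdist_le : cw; apply.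
have close : \forall t \near F, forall k, (k < K)%N -> `|l k - f t k| <= e1.
  apply: near_forall_ltn => k.
  by move/cvgrPdist_le : (fl k); apply.
near=> t.
have ftM : forall k, `|f t k| <= M by near: t.
have ftl : forall k, (k < K)%N -> `|l k - f t k| <= e1 by near: t.
have cwl : cvgn (series (fun k => w k * l k)).
  apply: cvg_series_dominated cwM => k.
  by rewrite normrM (ger0_norm (w0 k)) mulrC ler_wpM2r.
have cwf : cvgn (series (fun k => w k * f t k)).
  apply: cvg_series_dominated cwM => k.
  by rewrite normrM (ger0_norm (w0 k)) mulrC ler_wpM2r.
rewrite -lim_series_sub//.
pose v k := if (k < K)%N then e1 * w k else 2 * M * w k.
have vle k : `|w k * l k - w k * f t k| <= v k.
  rewrite -mulrBr normrM (ger0_norm (w0 k)) /v mulrC.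
  case: ifPn => kK; first by rewrite ler_wpM2r// ftl.
  by rewrite ler_wpM2r// (le_trans (ler_normB _ _))// mulrDl mul1r lerD.
have vsum n : series v n <= e.
  have v0 k : 0 <= v k by exact: le_trans (normr_ge0 _) (vle k).
  apply: (@le_trans _ _ (series v (K + n))).
    by apply: nondecreasing_series => //; rewrite leq_addl.
  rewrite /series/= (big_cat_nat (n := K)) ?leq_addr//=.
  rewrite (_ : \sum_(0 <= i < K) v i = e1 * series w K); last first.
    rewrite /series/= big_distrr/= !big_nat; apply: eq_bigr => i iK.
    by rewrite /v; case/andP: iK => _ ->.
  rewrite (_ : \sum_(K <= i < _) v i = 2 * M * (series w (K + n) - series w K)); last first.
    rewrite sub_series_geq ?leq_addr// big_distrr/= !big_nat.
    apply: eq_bigr => i /andP[Ki _].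
    by rewrite /v ltnNge Ki.
  have h1 : series w (K + n) <= W by exact: series_le_lim.
  have h2 : W - series w K <= e2 by exact: le_trans (ler_norm _) (HK K (leqnn K)).
  have h3 : series w K <= W by exact: series_le_lim.
  have : e1 * series w K <= e / 2.
    apply: (@le_trans _ _ (e1 * (W + 1))).
      by apply: ler_wpM2l; [exact: ltW|apply: (le_trans h3); rewrite lerDl].
    by rewrite /e1 le_eqVlt; apply/orP; left; apply/eqP; field; rewrite gt_eqF// ltr_wpDl.
  have : 2 * M * (series w (K + n) - series w K) <= e / 2.
    apply: (@le_trans _ _ (2 * (M + 1) * e2)).
      apply: ler_pM => //.
      - by rewrite mulr_ge0.
      - by rewrite subr_ge0; apply: nondecreasing_series; rewrite ?leq_addr.
      - by rewrite ler_wpM2l// lerDl.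
      - by apply: le_trans h2; rewrite lerD2r.
    by rewrite /e2 le_eqVlt; apply/orP; left; apply/eqP; field; rewrite gt_eqF// ltr_wpDl.
  by move=> h4 h5; rewrite [e]splitr lerD.
have cv : cvgn (series v).
  by apply: (@bounded_series_cvg _ e) => // k; exact: le_trans (normr_ge0 _) (vle k).
by apply: (le_trans (norm_lim_series_le vle cv)); exact: lim_series_le_bound.
Unshelve. all: by end_near. Qed.

End Series.

(** * The sum of the inverse squares *)

Section Basel.
Context {R : realType}.

Definition invsq (k : nat) : R := (k.+1%:R ^+ 2)^-1.

Lemma invsq_ge0 k : 0 <= invsq k.
Proof. by rewrite invr_ge0 exprn_ge0. Qed.

(** The term [1 / 4] is kept and the later terms [1 / (k + 2)^2] telescope under
    [1 / (k + 1) - 1 / (k + 2)]. Any bound less than 1 serves the contraction in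
    [mean_error_contract]. *)
Lemma series_invsqS_le n : series (fun k => invsq k.+1) n <= 3 / 4.
Proof.
suff H m : series (fun k => invsq k.+1) m.+1 <= 3 / 4 - (m.+2%:R)^-1.
  case: n => [|n]; first by rewrite /series/= big_geq.
  by apply: (le_trans (H n)); rewrite lerBlDr lerDl invr_ge0.
elim: m => [|m IH].
  by rewrite /series/= big_nat1 /invsq expr2; lra.
rewrite seriesSr; apply: (le_trans (lerD IH (lexx _))).
rewrite /invsq -addrA lerD2l.
have a0 : 0 < m%:R + 2 :> R by rewrite ltr_wpDl.
have -> : m.+3%:R = m%:R + 2 + 1 :> R by rewrite -!natr1; lra.
have -> : m.+2%:R = m%:R + 2 :> R by rewrite -!natr1; lra.
move: (_ + 2) a0 => a a0; have a10 : 0 < a + 1 by rewrite addr_gt0.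
rewrite -subr_ge0.
have -> : - (a + 1)^-1 - (- a^-1 + ((a + 1) ^+ 2)^-1) = (a * (a + 1) ^+ 2)^-1.
  by field; rewrite !gt_eqF.
by rewrite invr_ge0 mulr_ge0 ?exprn_ge0// ltW.
Qed.

Lemma cvg_series_invsqS : cvgn (series (fun k => invsq k.+1)).
Proof.
apply: (@bounded_series_cvg _ _ (3 / 4)) => [k|n]; first exact: invsq_ge0.
exact: series_invsqS_le.
Qed.

Lemma series_shift (u : nat -> R) n :
  series u n.+1 = u 0%N + series (fun k => u k.+1) n.
Proof. by rewrite /series/= big_nat_recl. Qed.

Lemma cvg_series_shift (u : nat -> R) l :
  series (fun k => u k.+1) @ \oo --> l -> series u @ \oo --> u 0%N + l.
Proof.
move=> ul; rewrite -(cvg_shiftS (series u)).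
under eq_fun do rewrite series_shift.
by apply: cvgD => //; exact: cvg_cst.
Qed.

Lemma cvg_series_invsq : cvgn (series invsq).
Proof. exact: cvgP (cvg_series_shift cvg_series_invsqS). Qed.

(** By the mean value theorem [sin x = x * cos c] with [0 < c < x]. *)
Lemma sin_bounds (x : R) : 0 < x -> x < pi / 2 -> x * cos x <= sin x <= x.
Proof.
move=> x0 xpi.
have [c /andP[c0 cx]] : exists2 c, 0 < c < x & sin x - sin 0 = cos c * (x - 0).
  have [|c] := @MVT _ sin cos 0 x x0 (fun t _ => is_derive_sin t).
    by apply: continuous_subspaceT; exact: continuous_sin.
  by rewrite in_itv/= => cx E; exists c.
rewrite sin0 !subr0 => ->; rewrite (mulrC (cos c)).
apply/andP; split; last by rewrite ler_piMr ?cos_le1// ltW.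
rewrite ler_pM2l//; apply: ltW; rewrite ltr_cos ?in_itv//=.
- by apply/andP; split; [exact: ltW|have := @pi_ge0 R; lra].
- by apply/andP; split; [exact: ltW|have := @pi_ge0 R; lra].
Qed.

(** This is [sin x <= x <= tan x], because [sin x ^- 2 = 1 + tan x ^- 2]. *)
Lemma csc2_bounds (x : R) : 0 < x -> x < pi / 2 ->
  x ^- 2 <= sin x ^- 2 <= x ^- 2 + 1.
Proof.
move=> x0 xpi; have /andP[xcs sx] := sin_bounds x0 xpi.
have c0 : 0 < cos x.
  by rewrite cos_gt0_pihalf// xpi andbT (lt_trans _ x0)// oppr_lt0 divr_gt0// pi_gt0.
have s0 : 0 < sin x by apply: lt_le_trans xcs; rewrite mulr_gt0.
apply/andP; split.
  by rewrite lef_pV2 ?posrE ?exprn_gt0// lerXn2r// nnegrE ltW.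
have -> : x ^- 2 + 1 = (x ^+ 2 / (1 + x ^+ 2))^-1.
  by field; rewrite !gt_eqF// addr_gt0// exprn_gt0.
have y0 : 0 < 1 + x ^+ 2 by rewrite addr_gt0// exprn_gt0.
rewrite lef_pV2 ?posrE ?exprn_gt0 ?divr_gt0 ?exprn_gt0//.
rewrite ler_pdivrMr// mulrDr mulr1 -lerBlDr.
have -> : x ^+ 2 - sin x ^+ 2 * x ^+ 2 = (x * cos x) ^+ 2.
  by rewrite exprMn cos2sin2; ring.
by rewrite lerXn2r// nnegrE ?mulr_ge0 ?ltW.
Qed.

Let csc2 (x : R) := sin x ^- 2.

Lemma csc2_double (x : R) : sin x != 0 -> cos x != 0 ->
  csc2 (x *+ 2) = (csc2 x + csc2 (pi / 2 - x)) / 4.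
Proof.
move=> s0 c0; rewrite /csc2.
have -> : sin (pi / 2 - x) = cos x by rewrite addrC sinDpihalf cosN.
rewrite sin_mulr2n -mulr_natl.
have -> : sin x ^- 2 + cos x ^- 2 = (sin x * cos x) ^- 2.
  have {1}-> : sin x ^- 2 = (1 - cos x ^+ 2)^-1 by rewrite -sin2cos2.
  rewrite exprMn (sin2cos2 x); field.
  by rewrite c0 -sin2cos2 expf_neq0.
by field; rewrite s0 c0.
Qed.

(** The nodes at level [n + 1] are the halves of those at level [n] and the
    complements of these halves to [pi / 2]. *)
Let node n k : R := (2 * k%:R + 1) * pi / (4 * 2 ^+ n).

Lemma node_bounds n k : (k < 2 ^ n)%N -> 0 < node n k < pi / 2.
Proof.
move=> kn; rewrite /node; apply/andP; split.
  by rewrite divr_gt0 ?mulr_gt0 ?pi_gt0 ?exprn_gt0// ltr_wpDl.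
rewrite ltr_pdivrMr ?mulr_gt0 ?exprn_gt0//.
rewrite [ltRHS](_ : _ = (2 * 2 ^+ n) * pi); last by field.
rewrite ltr_pM2r ?pi_gt0//.
by have : (2 * k + 1 < 2 * 2 ^ n)%N; [lia|rewrite -(ltr_nat R) natrD !natrM natrX].
Qed.

(** Each halving of the nodes multiplies the sum by 4, by [csc2_double]. *)
Lemma sum_csc2_node n : \sum_(0 <= k < 2 ^ n) csc2 (node n k) = 2 * 4 ^+ n.
Proof.
elim: n => [|n IH].
  have q : pi / 4 = pi / 2 - pi / 4 :> R by field.
  have E : sin (pi / 4) = cos (pi / 4) :> R by rewrite {1}q addrC sinDpihalf cosN.
  rewrite big_nat1 (_ : node 0 0 = pi / 4); last by rewrite /node expr0; field.
  have := cos2Dsin2 (pi / 4 : R); rewrite -E -mulr2n -mulr_natl expr0 mulr1 => h.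
  by rewrite /csc2 (_ : sin (pi / 4) ^+ 2 = 2^-1) ?invrK//; lra.
have e2 : (2 ^ n.+1 = 2 ^ n + 2 ^ n)%N by rewrite expnS mul2n addnn.
rewrite e2 (big_cat_nat (n := 2 ^ n)%N) ?leq_addr//=.
rewrite [X in _ + X](_ : _ = \sum_(0 <= k < 2 ^ n) csc2 (pi / 2 - node n.+1 k)).
  rewrite -big_split/= exprS mulrCA -IH big_distrr/= !big_nat.
  apply: eq_bigr => k /andP[_ kn].
  have -> : node n k = node n.+1 k *+ 2.
    by rewrite /node -mulr_natl exprS; field; rewrite expf_neq0.
  have /andP[p0 p1] : 0 < node n.+1 k < pi / 2.
    by apply: node_bounds; rewrite e2 ltn_addr.
  rewrite csc2_double; first by field.
  - by rewrite gt_eqF// sin_gt0_pihalf// p0.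
  - rewrite gt_eqF// cos_gt0_pihalf// p1 andbT (lt_trans _ p0)//.
    by rewrite oppr_lt0 divr_gt0// pi_gt0.
rewrite -{1}[(2 ^ n)%N]add0n big_addn addnK big_nat_rev/= !big_nat.
apply: eq_bigr => k /andP[_ kn]; congr csc2.
rewrite /node add0n.
have -> : (2 ^ n - k.+1 + 2 ^ n)%:R = 2 * 2 ^+ n - k%:R - 1 :> R.
  by rewrite natrD natrB// -natr1 natrX; ring.
by rewrite exprS; field; rewrite expf_neq0.
Qed.

Let oddsum m : R := \sum_(0 <= k < m) (2 * k%:R + 1) ^- 2.

(** [csc2_bounds] replaces [csc2] by the inverse square at each node, at a cost of
    at most 1 per node, against a total of order [4 ^ n]. *)
Lemma oddsum_bounds n :
  pi ^+ 2 / 8 - pi ^+ 2 / 16 / 2 ^+ n <= oddsum (2 ^ n) <= pi ^+ 2 / 8.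
Proof.
have P0 : 0 < pi ^+ 2 :> R by rewrite exprn_gt0 ?pi_gt0.
have T0 : 0 < 2 ^+ n :> R by rewrite exprn_gt0.
have scale : oddsum (2 ^ n) =
    pi ^+ 2 / (16 * 4 ^+ n) * \sum_(0 <= k < 2 ^ n) node n k ^- 2.
  rewrite big_distrr/=; apply: eq_bigr => k _.
  rewrite /node.
  have -> : 4 ^+ n = 2 ^+ n ^+ 2 :> R by rewrite -exprM mulnC exprM; congr (_ ^+ _); ring.
  have : 2 * k%:R + 1 != 0 :> R by rewrite gt_eqF// ltr_wpDl.
  have := gt_eqF T0; have := gt_eqF (@pi_gt0 R).
  move: (2 * k%:R + 1) (2 ^+ n) (@pi R) => b c p h1 h2 h3.
  by field; rewrite h1 h2 h3.
have F0 : 0 < 4 ^+ n :> R by rewrite exprn_gt0.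
have c0 : 0 < pi ^+ 2 / (16 * 4 ^+ n) :> R by rewrite divr_gt0// mulr_gt0.
have up : \sum_(0 <= k < 2 ^ n) node n k ^- 2 <= 2 * 4 ^+ n.
  rewrite -sum_csc2_node big_nat [leRHS]big_nat; apply: ler_sum => k /andP[_ kn].
  by have /andP[p0 p1] := node_bounds kn; have /andP[] := csc2_bounds p0 p1.
have lo : 2 * 4 ^+ n - 2 ^+ n <= \sum_(0 <= k < 2 ^ n) node n k ^- 2.
  rewrite -sum_csc2_node lerBlDr.
  rewrite [X in _ <= _ + X](_ : _ = \sum_(0 <= k < 2 ^ n) 1); last first.
    by rewrite big_const_nat subn0 iter_addr_0 natrX.
  rewrite -big_split/= big_nat [leRHS]big_nat; apply: ler_sum => k /andP[_ kn].
  by have /andP[p0 p1] := node_bounds kn; have /andP[] := csc2_bounds p0 p1.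
rewrite scale; apply/andP; split.
  apply: (@le_trans _ _ (pi ^+ 2 / (16 * 4 ^+ n) * (2 * 4 ^+ n - 2 ^+ n))).
    have -> : 4 ^+ n = 2 ^+ n ^+ 2 :> R by rewrite -exprM mulnC exprM; congr (_ ^+ _); ring.
    by rewrite le_eqVlt; apply/orP; left; apply/eqP; field; rewrite gt_eqF.
  by rewrite ler_pM2l.
apply: (@le_trans _ _ (pi ^+ 2 / (16 * 4 ^+ n) * (2 * 4 ^+ n))).
  by rewrite ler_pM2l.
by rewrite le_eqVlt; apply/orP; left; apply/eqP; field; rewrite gt_eqF.
Qed.

Lemma cvg_oddsum : oddsum (2 ^ n) @[n --> \oo] --> pi ^+ 2 / 8.
Proof.
apply: (@squeeze_cvgr _ _ _ _ (fun n => pi ^+ 2 / 8 - pi ^+ 2 / 16 / 2 ^+ n) (fun=> pi ^+ 2 / 8)).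
- by near=> n; exact: oddsum_bounds.
- rewrite -[X in _ --> X]subr0; apply: cvgB; first exact: cvg_cst.
  have -> : (fun n => pi ^+ 2 / 16 / 2 ^+ n) = geometric (pi ^+ 2 / 16 : R) 2^-1.
    by apply/funext => n /=; rewrite exprVn.
  by apply: cvg_geometric; rewrite ger0_norm// invf_lt1// ltr1n.
- exact: cvg_cst.
Unshelve. all: by end_near. Qed.

Lemma series_invsq_double m :
  series invsq m.*2 = oddsum m + series invsq m / 4.
Proof.
elim: m => [|m IH]; first by rewrite /oddsum /series/= !big_geq// mul0r addr0.
have h1 : invsq m.*2 = (2 * m%:R + 1) ^- 2.
  by rewrite /invsq -mul2n -natr1 natrM.
have h2 : invsq m.*2.+1 = invsq m / 4.
  rewrite /invsq; have -> : m.*2.+2%:R = 2 * m.+1%:R :> R.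
    by rewrite -natrM mul2n.
  by rewrite exprMn invfM mulrC; congr (_ * _); rewrite expr2; lra.
have -> : oddsum m.+1 = oddsum m + (2 * m%:R + 1) ^- 2 by exact: big_nat_recr.
rewrite doubleS !seriesSr IH h1 h2; lra.
Qed.

(** The terms with odd denominator add up to [pi^2 / 8], and the others are a
    quarter of the whole. *)
Theorem basel : series invsq @ \oo --> pi ^+ 2 / 6.
Proof.
have cZ' := cvg_series_invsq; move: cZ'; set Z := limn _ => cZ'.
have p2 : (2 ^ n)%N @[n --> \oo] --> \oo.
  apply/cvgnyPge => A; near=> n; apply: (leq_trans (n := n)).
    by near: n; exact: nbhs_infty_ge.
  exact: ltnW (ltn_expl _ _).
have c1 : series invsq (2 ^ n)%N @[n --> \oo] --> Z by exact: (cvg_comp _ _ p2 cZ').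
have c2 : series invsq (2 ^ n)%N.*2 @[n --> \oo] --> Z.
  have := c1; rewrite -(cvg_shiftS (fun n => series invsq (2 ^ n)%N)) => h.
  by under eq_fun do rewrite -mul2n -expnS.
have c3 : series invsq (2 ^ n)%N.*2 @[n --> \oo] --> pi ^+ 2 / 8 + Z / 4.
  under eq_fun do rewrite series_invsq_double.
  by apply: cvgD; [exact: cvg_oddsum|exact: cvgMr_tmp].
have E : Z = pi ^+ 2 / 8 + Z / 4 by apply: cvg_unique c2 c3.
suff -> : pi ^+ 2 / 6 = Z by [].
by lra.
Unshelve. all: by end_near. Qed.

End Basel.

(** * Laplace transforms of bounded coefficients *)

Section Laplace.
Context {R : realType}.
Implicit Types (s : R) (u : nat -> R).

Definition laplace u s : R := limn (series (fun n => u n * expR (- s) ^+ n)).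

Lemma near_at_right0P (P : R -> Prop) :
  (\forall s \near 0^'+, P s) <->
  exists2 d : R, 0 < d & forall s, 0 < s < d -> P s.
Proof.
split=> [[d /= d0 H]|[d d0 H]].
  exists d => // s /andP[s0 sd]; apply: H => //=.
  by rewrite sub0r normrN ger0_norm// ltW.
exists d => //= s /=; rewrite sub0r normrN => sd s0.
by apply: H; rewrite s0/= (le_lt_trans (ler_norm s)).
Qed.

Lemma near_at_right0_scale (c : R) (P : R -> Prop) : 0 < c ->
  (\forall s \near 0^'+, P s) -> \forall s \near 0^'+, P (c * s).
Proof.
move=> c0 /near_at_right0P[d d0 H]; apply/near_at_right0P.
exists (d / c); first by rewrite divr_gt0.
by move=> s /andP[s0 sd]; apply: H; rewrite mulr_gt0//= mulrC -ltr_pdivlMr.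
Qed.

Lemma cvg_at_right0_scale (f : R -> R) (c l : R) : 0 < c ->
  f s @[s --> 0^'+] --> l -> f (c * s) @[s --> 0^'+] --> l.
Proof.
move=> c0 /cvgrPdist_le fl; apply/cvgrPdist_le => e e0.
by apply: (near_at_right0_scale (P := fun s => `|l - f s| <= e) c0); exact: fl.
Qed.

Lemma near_at_right0_gt0 : \forall s \near (0 : R)^'+, 0 < s.
Proof. exact: nbhs_right_gt. Qed.

Lemma expRN_lt1 s : 0 < s -> expR (- s) < 1.
Proof. by move=> s0; rewrite expR_lt1 oppr_lt0. Qed.

Lemma expRN_le_inv1D s : 0 < s -> expR (- s) * (1 + s) <= 1.
Proof.
move=> s0; rewrite expRN mulrC ler_pdivrMr ?expR_gt0// mul1r.
exact: expR_ge1Dx.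
Qed.

(** The factor [1 / (1 - exp (-s))] of geometric sums is [1 / s] up to a bounded
    error. *)
Lemma ratio_bounds s : 0 < s -> 1 <= s / (1 - expR (- s)) <= 1 + s.
Proof.
move=> s0; have y1 : 0 < 1 - expR (- s) by rewrite subr_gt0 expRN_lt1.
rewrite ler_pdivlMr// ler_pdivrMr//; have := expRN_le_inv1D s0.
by have := @expR_ge1Dx R (- s); lra.
Qed.

Lemma series_expr_le (y : R) n : 0 <= y -> y < 1 ->
  \sum_(0 <= k < n) y ^+ k <= (1 - y)^-1.
Proof.
move=> y0 y1; have yn1 : y != 1 by rewrite lt_eqF.
have /(congr1 (fun f => f n)) := geometric_seriesE 1 yn1; rewrite /series/=.
under eq_bigr do rewrite mul1r.
move=> ->; rewrite mul1r ler_piMl ?invr_ge0 ?subr_ge0 ?(ltW y1)//.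
by rewrite lerBlDr lerDl exprn_ge0.
Qed.

Section BoundedCoefficients.
Variable u : nat -> R.
Hypotheses (u0 : u 0%N = 0) (u_ge0 : forall k, 0 <= u k) (u_le1 : forall k, u k <= 1).

Let cvg_pow s : 0 < s -> cvgn (series (fun k => expR (- s) ^+ k)).
Proof.
move=> s0; apply: (bounded_series_cvg (M := (1 - expR (- s))^-1)) => [k|n].
  by rewrite exprn_ge0// expR_ge0.
by apply: series_expr_le; [exact: expR_ge0|exact: expRN_lt1].
Qed.

Lemma laplace_cvg s : 0 < s -> cvgn (series (fun k => u k * expR (- s) ^+ k)).
Proof.
move=> s0; apply: cvg_series_dominated (cvg_pow s0) => k.
by rewrite ger0_norm ?mulr_ge0 ?exprn_ge0 ?expR_ge0// ler_piMl// exprn_ge0// expR_ge0.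
Qed.

Definition mean s := s * laplace u s.

(** The bound 1 holds for all [s], not only near 0, because [u] vanishes at 0;
    it is the domination needed in [log_mean]. *)
Lemma mean_bounds s : 0 < s -> 0 <= mean s <= 1.
Proof.
move=> s0; rewrite /mean; have cu := laplace_cvg s0.
have y0 := @expR_ge0 R (- s); have y1 := expRN_lt1 s0.
have t0 k : 0 <= u k * expR (- s) ^+ k by rewrite mulr_ge0// exprn_ge0.
rewrite mulr_ge0 ?(ltW s0)//=; last exact: lim_series_ge0.
rewrite mulrC -ler_pdivlMr// div1r; apply: lim_series_le_bound => // -[|n].
  by rewrite /series/= big_geq// invr_ge0 ltW.
rewrite series_shift/= u0 mul0r add0r.
apply: (@le_trans _ _ (expR (- s) * (1 - expR (- s))^-1)).
  apply: (le_trans _ (ler_wpM2l y0 (series_expr_le n y0 y1))).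
  rewrite /series/= big_distrr/=; apply: ler_sum => k _.
  by rewrite exprS ler_piMl// mulr_ge0// exprn_ge0.
rewrite ler_pdivrMr ?subr_gt0// mulrC ler_pdivlMr//.
by have := expRN_le_inv1D s0; lra.
Qed.

(** For the indicator function of a set of parts this is [s] times the logarithm
    of the generating function of partitions, see [log_gf]. *)
Definition log_mean s : R :=
  limn (series (fun k => invsq k * mean (k.+1%:R * s))).

Lemma cvg_log_mean s : 0 < s ->
  cvgn (series (fun k => invsq k * mean (k.+1%:R * s))).
Proof.
move=> s0; apply: cvg_series_dominated cvg_series_invsq => k.
have /andP[h0 h1] := @mean_bounds (k.+1%:R * s) (mulr_gt0 (ltr0Sn _ k) s0).
by rewrite ger0_norm ?(mulr_ge0 (invsq_ge0 k) h0)// ler_piMr// invsq_ge0.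
Qed.

Lemma lim_seriesMr (w : nat -> R) (a l : R) : series w @ \oo --> l ->
  limn (series (fun k => w k * a)) = a * l.
Proof.
move=> wl; under eq_fun do rewrite mulrC.
by rewrite lim_series_scale; [rewrite (cvg_lim _ wl)|exact: cvgP wl].
Qed.

Lemma cvg_log_mean_of_mean alpha : mean s @[s --> 0^'+] --> alpha ->
  log_mean s @[s --> 0^'+] --> pi ^+ 2 / 6 * alpha.
Proof.
move=> ha; rewrite mulrC -(lim_seriesMr alpha basel).
apply: (tannery (M := 1)) => [k|||]; first exact: invsq_ge0.
- exact: cvg_series_invsq.
- near=> s => k.
  have s0 : 0 < s by near: s; exact: near_at_right0_gt0.
  have /andP[h0 h1] := @mean_bounds (k.+1%:R * s) (mulr_gt0 (ltr0Sn _ k) s0).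
  by rewrite ger0_norm.
- by move=> k; exact: cvg_at_right0_scale.
Unshelve. all: by end_near. Qed.

(** The first term of [log_mean] is [mean s] itself, and the other weights sum
    to less than 1: a bound [D] on the error near 0 improves to
    [3 / 4 * D + e]. *)
Lemma mean_error_contract alpha D e :
  log_mean s @[s --> 0^'+] --> pi ^+ 2 / 6 * alpha -> 0 <= D -> 0 < e ->
  (\forall s \near 0^'+, `|mean s - alpha| <= D) ->
  \forall s \near 0^'+, `|mean s - alpha| <= 3 / 4 * D + e.
Proof.
move=> ga D0 e0 hD.
pose E s := mean s - alpha.
have [M DM aM] : exists2 M, D <= M & 1 + `|alpha| <= M.
  by exists (Num.max D (1 + `|alpha|)); rewrite le_max lexx ?orbT.
have EM s : 0 < s -> `|E s| <= M.
  move=> s0; have /andP[h0 h1] := mean_bounds s0.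
  apply: (le_trans (ler_normB _ _)); apply: le_trans aM.
  by rewrite lerD2r ger0_norm.
pose f s k := Num.max D `|E (k.+2%:R * s)|.
have fM s : 0 < s -> forall k, `|f s k| <= M.
  move=> s0 k; rewrite /f ger0_norm ?le_max ?D0// ge_max DM.
  by apply: EM; rewrite mulr_gt0.
have cf s : 0 < s -> cvgn (series (fun k => invsq k.+1 * f s k)).
  move=> s0; apply: (cvg_series_dominated (v := fun k => M * invsq k.+1)) => [k|].
    by rewrite normrM (ger0_norm (invsq_ge0 _)) mulrC ler_wpM2r ?invsq_ge0 ?fM.
  exact/is_cvg_series_scale/cvg_series_invsqS.
have key s : 0 < s -> `|E s| <=
    `|log_mean s - pi ^+ 2 / 6 * alpha| + limn (series (fun k => invsq k.+1 * f s k)).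
  move=> s0.
  have cg := cvg_log_mean s0.
  have ca : cvgn (series (fun k => invsq k * alpha)).
    by under eq_fun do rewrite mulrC; exact/is_cvg_series_scale/cvg_series_invsq.
  have cE : cvgn (series (fun k => invsq k.+1 * E (k.+2%:R * s))).
    apply: cvg_series_dominated (cf s s0) => k.
    by rewrite normrM (ger0_norm (invsq_ge0 _)) ler_wpM2l ?invsq_ge0// /f le_max lexx orbT.
  have split : log_mean s - pi ^+ 2 / 6 * alpha =
      E s + limn (series (fun k => invsq k.+1 * E (k.+2%:R * s))).
    rewrite [_ * alpha]mulrC -(lim_seriesMr alpha basel) -lim_series_sub//.
    apply: cvg_lim => //.
    rewrite [X in series X](_ : _ = fun k => invsq k * E (k.+1%:R * s)); last first.
      by apply/funext => k; rewrite mulrBr.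
    rewrite [X in X + _](_ : _ = invsq 0 * E (1%:R * s)); last first.
      by rewrite /invsq expr1n invr1 !mul1r.
    exact: (cvg_series_shift (u := fun k => invsq k * E (k.+1%:R * s))).
  rewrite (_ : E s = log_mean s - pi ^+ 2 / 6 * alpha -
      limn (series (fun k => invsq k.+1 * E (k.+2%:R * s)))); last by rewrite split addrK.
  apply: (le_trans (ler_normB _ _)); rewrite lerD2l.
  apply: norm_lim_series_le (cf s s0) => k.
  by rewrite normrM (ger0_norm (invsq_ge0 _)) ler_wpM2l ?invsq_ge0// /f le_max lexx orbT.
have limf : limn (series (fun k => invsq k.+1 * f s k)) @[s --> 0^'+] -->
    limn (series (fun k => invsq k.+1 * D)).
  apply: (tannery (M := M)) => [k|||].
  - exact: invsq_ge0.
  - exact: cvg_series_invsqS.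
  - by near=> s; apply: fM; near: s; exact: near_at_right0_gt0.
  - move=> k; apply: cvg_near_cst; near=> s; rewrite /f; apply/max_idPl; near: s.
    by apply: (near_at_right0_scale (P := fun s => `|E s| <= D)).
have D34 : limn (series (fun k => invsq k.+1 * D)) <= 3 / 4 * D.
  rewrite (lim_seriesMr D cvg_series_invsqS) mulrC ler_wpM2r//.
  by apply: lim_series_le_bound; [exact: series_invsqS_le|exact: cvg_series_invsqS].
near=> s.
have s0 : 0 < s by near: s; exact: near_at_right0_gt0.
apply: (le_trans (key s s0)).
have h1 : `|pi ^+ 2 / 6 * alpha - log_mean s| <= e / 2.
  by near: s; move/cvgrPdist_le : ga; apply; rewrite divr_gt0.
have h2 : `|limn (series (fun k => invsq k.+1 * D)) - limn (series (fun k => invsq k.+1 * f s k))| <= e / 2.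
  by near: s; move/cvgrPdist_le : limf; apply; rewrite divr_gt0.
rewrite distrC in h1.
have := le_trans (ler_norm _) h1; rewrite distrC in h2.
have := le_trans (ler_norm _) h2.
by move: (limn _) (limn _) D34 h1 => a b; lra.
Unshelve. all: by end_near. Qed.

(** Iterating [mean_error_contract] from the trivial bound [1 + |alpha|]. *)
Lemma cvg_mean_of_log_mean alpha :
  log_mean s @[s --> 0^'+] --> pi ^+ 2 / 6 * alpha ->
  mean s @[s --> 0^'+] --> alpha.
Proof.
move=> ga; pose M := 1 + `|alpha|; have M0 : 0 < M by rewrite ltr_pwDl.
have iter n : \forall s \near 0^'+, `|mean s - alpha| <= M * (7 / 8) ^+ n.
  elim: n => [|n IH].
    near=> s; have s0 : 0 < s by near: s; exact: near_at_right0_gt0.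
    have /andP[h0 h1] := mean_bounds s0.
    apply: (le_trans (ler_normB _ _)).
    by rewrite mulr1 lerD2r ger0_norm.
  have D0 : 0 < M * (7 / 8) ^+ n by rewrite mulr_gt0// exprn_gt0// divr_gt0.
  have e0 : 0 < M * (7 / 8) ^+ n / 8 by rewrite divr_gt0.
  have := mean_error_contract ga (ltW D0) e0 IH.
  apply: filterS => s /le_trans; apply; rewrite exprS.
  by move: (_ ^+ n) => a; lra.
have cM : (fun n => M * (7 / 8) ^+ n) @ \oo --> 0.
  by apply: (@cvg_geometric R M (7 / 8)); rewrite ger0_norm; lra.
apply/cvgrPdist_le => e e0.
have [N _ HN] : \forall n \near \oo, `|0 - M * (7 / 8) ^+ n| <= e.
  by move/cvgrPdist_le : cM; apply.
have := iter N; apply: filterS => s hs.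
rewrite distrC (le_trans hs)//; apply: (le_trans _ (HN N (leqnn N))).
by rewrite sub0r normrN ler_norm.
Unshelve. all: by end_near. Qed.

End BoundedCoefficients.

End Laplace.

(** * From densities to Laplace transforms *)

Section Abelian.
Context {R : realType}.
Implicit Types (s : R).

(** Abel summation: as the weights decrease, the weighted sum stays above the
    last weight times the unweighted sum. *)
Lemma abel_nonneg (d : nat -> R) (y : R) n : 0 <= y -> y <= 1 ->
  (forall m, 0 <= series d m.+1) -> 0 <= series (fun k => d k * y ^+ k) n.
Proof.
move=> y0 y1 dge0; case: n => [|n]; first by rewrite /series/= big_geq.
apply: (@le_trans _ _ (y ^+ n * series d n.+1)).
  by rewrite mulr_ge0// exprn_ge0.
elim: n => [|n IH]; first by rewrite /series/= !big_nat1 expr0 mul1r mulr1.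
rewrite (seriesSr d n.+1) [leRHS]seriesSr mulrDr [_ * d _]mulrC lerD2r.
apply: le_trans IH; rewrite ler_wpM2r// exprS ler_piMl// exprn_ge0//.
Qed.

(** The domination of partial sums passes to the weighted sums, although the
    terms [v k] themselves need not be dominated by [c k]. *)
Lemma abel_majorized (v c : nat -> R) (y : R) n : 0 <= y -> y <= 1 ->
  (forall m, `|series v m.+1| <= series c m.+1) ->
  `|series (fun k => v k * y ^+ k) n| <= series (fun k => c k * y ^+ k) n.
Proof.
move=> y0 y1 vc.
have sE (a b : R) m : series (fun k => a * v k + b * c k) m =
    a * series v m + b * series c m.
  by rewrite /series/= big_split/= !big_distrr.
have sE' (a b : R) m : series (fun k => (a * v k + b * c k) * y ^+ k) m =
    a * series (fun k => v k * y ^+ k) m + b * series (fun k => c k * y ^+ k) m.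
  rewrite /series/= !big_distrr/= -big_split/=; apply: eq_bigr => k _.
  by rewrite mulrDl !mulrA.
rewrite ler_norml; apply/andP; split.
  have := @abel_nonneg (fun k => 1 * v k + 1 * c k) y n y0 y1.
  rewrite sE' !mul1r => h; rewrite -subr_ge0 opprK; apply: h => m.
  by rewrite sE !mul1r; have := vc m; rewrite ler_norml => /andP[]; lra.
have := @abel_nonneg (fun k => -1 * v k + 1 * c k) y n y0 y1.
rewrite sE' !mul1r mulN1r addrC => h; rewrite -subr_ge0; apply: h => m.
by rewrite sE !mul1r mulN1r; have := vc m; rewrite ler_norml => /andP[]; lra.
Qed.

Variable u : nat -> R.
Hypotheses (u_ge0 : forall k, 0 <= u k) (u_le1 : forall k, u k <= 1).

Definition counting_density alpha :=
  series u (Num.truncn x).+1 / x @[x --> +oo%R] --> (alpha : R).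

Lemma counting_density_linear alpha e : counting_density alpha -> 0 < e ->
  exists2 C, 0 <= C &
  forall n, `|series u n.+1 - alpha * n.+1%:R| <= e * n.+1%:R + C.
Proof.
move=> /cvgrPdist_le ua e0; have [x0 [_ H]] := ua e e0.
pose n0 := (Num.truncn x0).+1.
have su m : 0 <= series u m <= m%:R.
  rewrite sumr_ge0//= -[leRHS](_ : \sum_(0 <= k < m) 1 = _).
    exact: ler_sum.
  by rewrite big_const_nat subn0 iter_addr_0.
exists ((1 + `|alpha|) * n0.+1%:R) => [|n]; first by rewrite mulr_ge0// addr_ge0.
have [nn0|nn0] := ltnP n n0.
  apply: (le_trans (ler_normB _ _)); rewrite ler_wpDl//.
    by rewrite mulr_ge0// ltW.
  have /andP[s0 s1] := su n.+1.
  rewrite (ger0_norm s0) normrM (ger0_norm (ler0n _ n.+1)) mulrDl mul1r.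
  have nn : n.+1%:R <= n0.+1%:R :> R by rewrite ler_nat ltnW.
  by apply: lerD; [exact: le_trans nn|rewrite ler_wpM2l].
have n_gt0 : 0 < n%:R :> R by rewrite ltr0n (leq_trans _ nn0).
have x0n : x0 < n%:R.
  by rewrite (lt_le_trans (truncnS_gt x0))// ler_nat.
have := H _ x0n; rewrite natrK => hn.
have hn' : `|series u n.+1 - alpha * n%:R| <= e * n%:R.
  have -> : series u n.+1 - alpha * n%:R = - ((alpha - series u n.+1 / n%:R) * n%:R).
    by field; rewrite gt_eqF.
  by rewrite normrN normrM (ger0_norm (ler0n _ n)) ler_wpM2r.
have -> : series u n.+1 - alpha * n.+1%:R = (series u n.+1 - alpha * n%:R) - alpha.
  by rewrite -natr1; ring.
apply: (le_trans (ler_normB _ _)); apply: lerD.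
  by apply: (le_trans hn'); rewrite ler_wpM2l ?(ltW e0)// ler_nat.
apply: (@le_trans _ _ ((1 + `|alpha|) * 1)); first by rewrite mulr1 lerDr.
by rewrite ler_wpM2l ?addr_ge0// ler1n.
Qed.

(** By [counting_density_linear] the partial sums of [u - alpha] are dominated by
    those of the sequence that is [e + C] at 0 and [e] elsewhere; the transform
    of the latter is [C + e / (1 - exp (-s))]. *)
Lemma cvg_mean_of_density alpha : counting_density alpha ->
  mean u s @[s --> 0^'+] --> alpha.
Proof.
move=> ua; apply/cvgrPdist_le => e e0.
have e20 : 0 < e / 2 by rewrite divr_gt0.
have [C C0 HC] := counting_density_linear ua e20.
have bnd s : 0 < s -> `|mean u s - alpha * (s / (1 - expR (- s)))| <=
    s * C + e / 2 * (s / (1 - expR (- s))).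
  move=> s0; set y := expR (- s).
  have y0 : 0 <= y by exact: expR_ge0.
  have y1 : y < 1 by exact: expRN_lt1.
  have cu := laplace_cvg u_ge0 u_le1 s0.
  pose v k := u k - alpha; pose c k := e / 2 + (if k == 0%N then C else 0).
  have sv m : series v m = series u m - alpha * m%:R.
    by rewrite /series/= sumrB big_const_nat subn0 iter_addr_0 mulr_natr.
  have sumr0 m : \sum_(0 <= k < m) (0 : R) = 0 by apply: big1.
  have sc (g : nat -> R) m : series (fun k => c k * g k) m.+1 =
      e / 2 * series g m.+1 + C * g 0%N.
    rewrite /series/= (eq_bigr (fun k => e / 2 * g k + (if k == 0%N then C * g k else 0))); last first.
      by move=> k _; rewrite /c; case: ifP => _; rewrite mulrDl// mul0r.
    by rewrite big_split/= -big_distrr/= [X in _ + X = _]big_nat_recl//= sumr0 addr0.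
  have maj n := @abel_majorized v c y n y0 (ltW y1).
  have geo : series (fun k => y ^+ k) @ \oo --> (1 - y)^-1.
    have := @cvg_geometric_series R 1 y; rewrite ger0_norm// mul1r => /(_ y1).
    by rewrite (_ : geometric 1 y = fun k => y ^+ k)//; apply/funext => k /=; rewrite mul1r.
  have geoa : series (fun k => v k * y ^+ k) @ \oo --> laplace u s - alpha * (1 - y)^-1.
    have -> : (fun k => v k * y ^+ k) = (fun k => u k * y ^+ k - alpha * y ^+ k).
      by apply/funext => k; rewrite mulrBl.
    rewrite -(cvg_lim _ geo)// -lim_series_scale; last exact: cvgP geo.
    rewrite -lim_series_sub//; last exact/is_cvg_series_scale/(cvgP _ geo).
    by apply: is_cvg_series_sub => //; exact/is_cvg_series_scale/(cvgP _ geo).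
  have lim : `|laplace u s - alpha * (1 - y)^-1| <= C + e / 2 * (1 - y)^-1.
    have cn : `|series (fun k => v k * y ^+ k) n| @[n --> \oo] -->
        `|laplace u s - alpha * (1 - y)^-1| by exact: cvg_norm.
    rewrite -(cvg_lim _ cn)//; apply: limr_le; first exact: cvgP cn.
    near=> n; case: (n) => [|m0].
      rewrite /series/= big_geq// normr0 addr_ge0// mulr_ge0 ?(ltW e20)//.
      by rewrite invr_ge0 subr_ge0 ltW.
    apply: le_trans (maj m0.+1 _) _ => [m|].
      have := sc (fun=> 1) m; rewrite mulr1 sv.
      under eq_fun do rewrite mulr1.
      move=> ->; rewrite /series/= big_const_nat subn0 iter_addr_0.
      exact: HC.
    rewrite sc expr0 mulr1 addrC lerD2l ler_wpM2l ?(ltW e20)//.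
    exact: series_expr_le.
  rewrite /mean (_ : s * _ - _ = s * (laplace u s - alpha * (1 - y)^-1)); last by ring.
  rewrite normrM (ger0_norm (ltW s0)).
  by rewrite (_ : s * C + _ = s * (C + e / 2 * (1 - y)^-1)) ?ler_pM2l//; ring.
pose K := C + e / 2 + `|alpha|; have K0 : 0 < K + 1.
  by rewrite ltr_wpDl// !addr_ge0// ltW.
apply/near_at_right0P; exists (e / 2 / (K + 1)); first by rewrite divr_gt0.
move=> s /andP[s0]; rewrite ltr_pdivlMr// => sK.
have /andP[q1 q2] := ratio_bounds s0.
have := bnd s s0; move: (s / _) q1 q2 => q q1 q2 h.
rewrite distrC (_ : _ - alpha = (mean u s - alpha * q) + alpha * (q - 1)); last by ring.
apply: (le_trans (ler_normD _ _)); rewrite normrM.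
have a1 : `|alpha| * `|q - 1| <= `|alpha| * s.
  by rewrite ler_wpM2l// ger0_norm; lra.
apply: (le_trans (lerD h a1)).
have : e / 2 * q <= e / 2 * (1 + s) by rewrite ler_pM2l.
by rewrite /K in sK; lra.
Unshelve. all: by end_near. Qed.

End Abelian.

(** * From Laplace transforms to densities *)

Section Tauberian.
Context {R : realType}.
Implicit Types (s z : R).

Lemma bernoulli z M : -1 <= z -> 1 + M%:R * z <= (1 + z) ^+ M.
Proof.
move=> z1; elim: M => [|M IH]; first by rewrite mul0r addr0 expr0.
rewrite exprS; apply: (@le_trans _ _ ((1 + z) * (1 + M%:R * z))).
  rewrite -natr1; have : 0 <= M%:R * z ^+ 2 by rewrite mulr_ge0// sqr_ge0.
  by rewrite expr2; lra.
by rewrite ler_wpM2l//; lra.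
Qed.

(** [(1 - z)^M * (1 + M z) <= (1 - z)^M * (1 + z)^M <= 1]. *)
Lemma power_complement_le z M : 0 < z -> z <= 1 -> (0 < M)%N ->
  (1 - z) ^+ M <= (M%:R * z)^-1.
Proof.
move=> z0 z1 M0.
have Mz : 0 < M%:R * z by rewrite mulr_gt0// ltr0n.
rewrite -[leRHS]div1r ler_pdivlMr//.
apply: (@le_trans _ _ ((1 - z) ^+ M * (1 + z) ^+ M)).
  rewrite ler_wpM2l ?exprn_ge0 ?subr_ge0//.
  by apply: le_trans (bernoulli M _); lra.
rewrite -exprMn exprn_ile1//.
  by rewrite mulr_ge0; lra.
have : 0 <= z * z by rewrite mulr_ge0// ltW.
by lra.
Qed.

Lemma smooth_step_le z M : 0 <= z -> z <= 1 -> 1 - (1 - z) ^+ M <= M%:R * z.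
Proof. by move=> z0 z1; have := @bernoulli (- z) M; lra. Qed.

Lemma smooth_step_bounds z M : 0 <= z -> z <= 1 -> 0 <= 1 - (1 - z) ^+ M <= 1.
Proof.
move=> z0 z1; rewrite subr_ge0 gerBl exprn_ge0 ?subr_ge0// exprn_ile1 ?subr_ge0//.
by rewrite gerBl.
Qed.

Definition harmonic_sum (M : nat) : R := \sum_(0 <= i < M) (i.+1%:R)^-1.

Lemma lnB_le (a b : R) : 0 < a -> 0 < b -> ln b - ln a <= (b - a) / a.
Proof.
move=> a0 b0; rewrite -ln_div ?posrE//.
have -> : b / a = 1 + (b - a) / a by field; rewrite gt_eqF.
apply: le_ln1Dx; rewrite ltr_pdivlMr//; lra.
Qed.

Lemma harmonic_sumS M : harmonic_sum M.+1 = harmonic_sum M + (M.+1%:R)^-1.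
Proof. by rewrite /harmonic_sum big_nat_recr. Qed.

Lemma ln_le_harmonic_sum M : ln M.+1%:R <= harmonic_sum M.
Proof.
elim: M => [|M IH]; first by rewrite /harmonic_sum big_geq// ln1.
have := @lnB_le M.+1%:R M.+2%:R (ltr0Sn _ _) (ltr0Sn _ _).
rewrite harmonic_sumS (_ : _.+2%:R - _ = 1) ?div1r; last by rewrite -[M.+2%:R]natr1; lra.
by move: (_^-1) => c; lra.
Qed.

Lemma harmonic_sum_le_ln M : harmonic_sum M.+1 <= 1 + ln M.+1%:R.
Proof.
elim: M => [|M IH].
  by rewrite harmonic_sumS /harmonic_sum big_geq// ln1 invr1 addr0 add0r.
have := @lnB_le M.+2%:R M.+1%:R (ltr0Sn _ _) (ltr0Sn _ _).
rewrite harmonic_sumS (_ : _.+1%:R - _ = -1) ?mulN1r; last by rewrite -[M.+2%:R]natr1; lra.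
by move: (_^-1) => c; lra.
Qed.

Variable u : nat -> R.
Hypotheses (u_ge0 : forall k, 0 <= u k) (u_le1 : forall k, u k <= 1).

Let moment_term j i s k :=
  u k * ((expR (- s) ^+ k) ^+ j.+1 * (1 - expR (- s) ^+ k) ^+ i).

Let pow01 s k : 0 < s -> 0 <= expR (- s) ^+ k <= 1.
Proof.
by move=> s0; rewrite exprn_ge0 ?expR_ge0// exprn_ile1 ?expR_ge0// ltW// expRN_lt1.
Qed.

Lemma moment_cvg j i s : 0 < s -> cvgn (series (moment_term j i s)).
Proof.
move=> s0; apply: cvg_series_dominated (laplace_cvg u_ge0 u_le1 s0) => k.
have /andP[] := pow01 k s0; rewrite /moment_term; move: (_ ^+ k) => z z0 z1.
have z1' : 0 <= 1 - z <= 1 by rewrite subr_ge0 z1 gerBl.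
have [a0 a1] : 0 <= (1 - z) ^+ i /\ (1 - z) ^+ i <= 1.
  by case/andP: z1' => ? ?; split; [exact: exprn_ge0|exact: exprn_ile1].
have b0 := exprn_ge0 j.+1 z0.
rewrite ger0_norm ?mulr_ge0// ler_wpM2l//.
apply: (@le_trans _ _ (z ^+ j.+1)); first by rewrite ler_piMr.
by rewrite exprS ler_piMr// exprn_ile1.
Qed.

(** The integral of [z^j (1 - z)^i] over [[0, 1]]. *)
Let beta j i : R := (j`! * i`!)%:R / (j + i).+1`!%:R.

Let betaS j i : beta j i.+1 = beta j i - beta j.+1 i.
Proof.
have f0 n : (n`!)%:R != 0 :> R by rewrite pnatr_eq0 -lt0n fact_gt0.
rewrite /beta addnS addSn (factS (j + i).+1) (factS j) (factS i).
have := f0 (j + i).+1; have : (j + i).+2%:R != 0 :> R by rewrite pnatr_eq0.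
have -> : (j + i).+2%:R = j.+1%:R + i.+1%:R :> R by rewrite -natrD addSn addnS.
move: (j`!) (i`!) ((j + i).+1`!) => A B C; rewrite (natrM _ A B).
have -> : (A * (i.+1 * B))%:R = A%:R * i.+1%:R * B%:R :> R by rewrite !natrM mulrA.
have -> : (j.+1 * A * B)%:R = j.+1%:R * A%:R * B%:R :> R by rewrite !natrM.
have -> : ((j + i).+2 * C)%:R = (j.+1%:R + i.+1%:R) * C%:R :> R.
  by rewrite natrM -natrD addSn addnS.
move: (A%:R) (B%:R) (C%:R) (j.+1%:R) (i.+1%:R) => a b c d e h1 h2.
by field; rewrite h1 h2.
Qed.

(** Multiplying by [1 - z] subtracts from a moment the next one, so everything
    reduces to [i = 0], which is [mean] at the argument [(j + 1) s]. *)
Lemma cvg_moment (alpha : R) j i : mean u s @[s --> 0^'+] --> alpha ->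
  s * limn (series (moment_term j i s)) @[s --> 0^'+] --> alpha * beta j i.
Proof.
move=> ua; elim: i j => [|i IH] j.
  have -> : alpha * beta j 0 = j.+1%:R^-1 * alpha.
    rewrite mulrC; congr (_ * _); rewrite /beta fact0 muln1 addn0 factS natrM.
    have : (j`!)%:R != 0 :> R by rewrite pnatr_eq0 -lt0n fact_gt0.
    have : j.+1%:R != 0 :> R by [].
    by move: (_`!%:R) (_.+1%:R) => a b h1 h2; field; rewrite h1 h2.
  rewrite [X in X @ _ --> _](_ : _ = fun s => j.+1%:R^-1 * mean u (j.+1%:R * s)).
    by apply: cvgM; [exact: cvg_cst|exact: cvg_at_right0_scale].
  apply/funext => s; rewrite /mean /laplace !mulrA mulVf// mul1r; congr (_ * _).
  apply: eq_lim_series => k; rewrite /moment_term expr0 mulr1; congr (_ * _).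
  by rewrite -exprM mulnC exprM -expRM_natl mulrN.
rewrite betaS mulrBr.
have near_eq : \forall s \near 0^'+, s * limn (series (moment_term j i s)) -
    s * limn (series (moment_term j.+1 i s)) = s * limn (series (moment_term j i.+1 s)).
  near=> s; have s0 : 0 < s by near: s; exact: near_at_right0_gt0.
  rewrite -mulrBr -lim_series_sub; [|exact: moment_cvg..].
  congr (_ * _); apply: eq_lim_series => k.
  by rewrite /moment_term; move: (_ ^+ k) => z; rewrite (exprS z j.+1) (exprS (1 - z)); ring.
apply: (cvg_trans (near_eq_cvg near_eq)).
by apply: cvgB; exact: IH.
Unshelve. all: by end_near. Qed.

Let step_term M s k := u k * (1 - (1 - expR (- s) ^+ k) ^+ M).

Lemma step_cvg M s : 0 < s -> cvgn (series (step_term M s)).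
Proof.
move=> s0; apply: (@cvg_series_dominated _ _ (fun k => M%:R * (u k * expR (- s) ^+ k))) => [k|].
  have /andP[y0 y1] := pow01 k s0.
  have /andP[q0 q1] := smooth_step_bounds M y0 y1.
  rewrite ger0_norm; last by rewrite mulr_ge0.
  by rewrite mulrCA ler_wpM2l// smooth_step_le.
exact/is_cvg_series_scale/laplace_cvg.
Qed.

(** [1 - (1 - z)^M] is the sum of [z (1 - z)^i] over [i < M], and the moment
    [j = 0] has limit [alpha / (i + 1)]. *)
Lemma cvg_step (alpha : R) M : mean u s @[s --> 0^'+] --> alpha ->
  s * limn (series (step_term M s)) @[s --> 0^'+] --> alpha * harmonic_sum M.
Proof.
move=> ua; elim: M => [|M IH].
  rewrite /harmonic_sum big_geq// mulr0 (_ : (fun s => _) = fun=> 0); first exact: cvg_cst.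
  apply/funext => s; rewrite (_ : step_term 0 s = fun=> 0); last first.
    by apply/funext => k; rewrite /step_term expr0 subrr mulr0.
  rewrite (_ : series _ = fun=> 0) ?lim_cst ?mulr0//.
  by apply/funext => n; rewrite /series/= big1.
rewrite harmonic_sumS mulrDr.
have near_eq : \forall s \near 0^'+, s * limn (series (step_term M s)) +
    s * limn (series (moment_term 0 M s)) = s * limn (series (step_term M.+1 s)).
  near=> s; have s0 : 0 < s by near: s; exact: near_at_right0_gt0.
  rewrite -mulrDr -lim_series_add; [|exact: step_cvg|exact: moment_cvg].
  congr (_ * _); apply: eq_lim_series => k.
  by rewrite /moment_term /step_term; move: (_ ^+ k) => z; rewrite (exprS (1 - z)) expr1; ring.
apply: (cvg_trans (near_eq_cvg near_eq)).
apply: cvgD; first exact: IH.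
have -> : M.+1%:R^-1 = beta 0 M.
  rewrite /beta fact0 mul1n add0n factS natrM.
  have : (M`!)%:R != 0 :> R by rewrite pnatr_eq0 -lt0n fact_gt0.
  have : M.+1%:R != 0 :> R by rewrite pnatr_eq0.
  by move: (_`!%:R) (_.+1%:R) => a b h1 h2; field; rewrite h1 h2.
exact: cvg_moment.
Unshelve. all: by end_near. Qed.

(** The smooth step [1 - (1 - z)^M] at [z = e^(-ks)] crosses from 1 to 0 at
    [k = ln M / s], with geometric errors on both sides of the crossing. *)
Lemma counting_vs_step M s x : 0 < s -> (0 < M)%N -> 0 <= x -> s * x = ln M%:R ->
  `|series u (Num.truncn x).+1 - limn (series (step_term M s))| <=
  (1 - expR (- s))^-1.
Proof.
move=> s0 M0 x0 sx; set X := Num.truncn x; set y := expR (- s).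
have y0 : 0 < y by exact: expR_gt0.
have y1 : y < 1 by exact: expRN_lt1.
have Mp : 0 < M%:R :> R by rewrite ltr0n.
have MV : M%:R^-1 = expR (- (s * x)) by rewrite sx expRN lnK ?posrE.
have Xx : X%:R <= x by rewrite truncn_le.
have xX : x < X.+1%:R by exact: truncnS_gt.
have yX : M%:R^-1 <= y ^+ X.
  by rewrite MV -expRM_natl ler_expR mulrN lerN2 mulrC ler_pM2l.
have yX1 : M%:R * y ^+ X.+1 <= 1.
  rewrite mulrC -ler_pdivlMr// div1r MV -expRM_natl ler_expR mulrN lerN2 mulrC.
  by rewrite ler_pM2r// ltW.
have Q01 k := smooth_step_bounds M (andP (pow01 k s0)).1 (andP (pow01 k s0)).2.
have early k : (k < X.+1)%N -> u k * (1 - y ^+ k) ^+ M <= y ^+ (X - k).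
  rewrite ltnS => kX.
  have /andP[z0 z1] := pow01 k s0; have zp : 0 < y ^+ k by rewrite exprn_gt0.
  apply: (@le_trans _ _ ((1 - y ^+ k) ^+ M)).
    by rewrite ler_piMl// exprn_ge0// subr_ge0.
  apply: (le_trans (power_complement_le zp z1 M0)).
  by rewrite invfM ler_pdivrMr// -exprD subnK.
have late k : (X < k)%N -> u k * (1 - (1 - y ^+ k) ^+ M) <= y ^+ (k - X.+1).
  move=> Xk; have /andP[z0 z1] := pow01 k s0.
  have /andP[q0 q1] := smooth_step_bounds M z0 z1.
  apply: (@le_trans _ _ (1 - (1 - y ^+ k) ^+ M)); first by rewrite ler_piMl.
  apply: (le_trans (smooth_step_le M z0 z1)).
  have -> : y ^+ k = y ^+ (k - X.+1) * y ^+ X.+1 by rewrite -exprD subnK.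
  by rewrite mulrCA ler_piMr// exprn_ge0// ltW.
have geo n := series_expr_le n (ltW y0) y1.
have before : 0 <= series u X.+1 - series (step_term M s) X.+1 <= (1 - y)^-1.
  have -> : series u X.+1 - series (step_term M s) X.+1 =
      \sum_(0 <= k < X.+1) u k * (1 - y ^+ k) ^+ M.
    rewrite /series/= -sumrB; apply: eq_bigr => k _.
    by rewrite /step_term -/y; ring.
  apply/andP; split.
    apply: sumr_ge0 => k _; rewrite mulr_ge0// exprn_ge0// subr_ge0.
    by have /andP[] := pow01 k s0.
  apply: le_trans (geo X.+1); rewrite [leRHS]big_nat_rev/= big_nat [leRHS]big_nat.
  by apply: ler_sum => k /andP[_ kX]; rewrite add0n subSS; exact: early.
have after n : (X < n)%N ->
    0 <= series (step_term M s) n - series (step_term M s) X.+1 <= (1 - y)^-1.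
  move=> Xn; rewrite sub_series_geq//; apply/andP; split.
    by apply: sumr_ge0 => k _; rewrite mulr_ge0//; have /andP[] := Q01 k.
  apply: le_trans (geo (n - X.+1)%N).
  rewrite -{1}[X.+1]add0n big_addn big_nat [leRHS]big_nat.
  by apply: ler_sum => k _; rewrite -{2}(addnK X.+1 k); apply: late; rewrite addnS ltnS leq_addl.
have cd : `|series u X.+1 - series (step_term M s) n| @[n --> \oo] -->
    `|series u X.+1 - limn (series (step_term M s))|.
  by apply: cvg_norm; apply: cvgB; [exact: cvg_cst|exact: step_cvg].
rewrite -(cvg_lim _ cd)//; apply: limr_le; first exact: cvgP cd.
near=> n; have /after/andP[a0 a1] : (X < n)%N by near: n; exact: nbhs_infty_gt.
by case/andP: before => b0 b1; rewrite ler_norml; apply/andP; split; lra.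
Unshelve. all: by end_near. Qed.

(** With [s = ln M / x], [counting_vs_step] compares [s] times the counting
    function at [x] with a quantity close to [alpha * ln M], up to a constant.
    Dividing by [s * x = ln M] leaves an error of order [1 / ln M]. *)
Lemma density_of_cvg_mean (alpha : R) :
  mean u s @[s --> 0^'+] --> alpha -> counting_density u alpha.
Proof.
move=> ua; apply/cvgrPdist_le => e e0.
pose K := 3 + `|alpha|; have K0 : 0 < K by rewrite ltr_pwDl.
(* [K] adds up 1 for the limit in [cvg_step], 2 for [counting_vs_step] and
   [|alpha|] for the harmonic sum. *)
pose M := (Num.truncn (expR (K / e))).+1.
have lnM : K / e <= ln M%:R.
  by rewrite -[K / e]expRK ler_ln ?posrE ?expR_gt0// ltW// truncnS_gt.
have lnM0 : 0 < ln M%:R :> R by apply: lt_le_trans lnM; rewrite divr_gt0.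
have /near_at_right0P[d d0 Hd] : \forall s \near 0^'+,
    `|alpha * harmonic_sum M - s * limn (series (step_term M s))| <= 1.
  by move/cvgrPdist_le : (@cvg_step alpha M ua); apply.
have dx0 : 0 < Num.max (ln M%:R / d) (ln M%:R) + 1.
  by rewrite ltr_wpDl// le_max (ltW lnM0) orbT.
near=> x.
have xbig : Num.max (ln M%:R / d) (ln M%:R) + 1 < x.
  by near: x; apply: nbhs_pinfty_gt; exact: num_real.
have x0 : 0 < x by exact: lt_trans xbig.
have [xd x1] : ln M%:R / d < x /\ ln M%:R < x.
  have : Num.max (ln M%:R / d) (ln M%:R) < x by lra.
  by rewrite gt_max => /andP[].
pose s := ln M%:R / x.
have s0 : 0 < s by rewrite divr_gt0.
have s1 : s < 1 by rewrite ltr_pdivrMr// mul1r.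
have sd : s < d by rewrite ltr_pdivrMr// mulrC -ltr_pdivrMr.
have sx : s * x = ln M%:R by rewrite divfK// gt_eqF.
have h1 := Hd s (introT andP (conj s0 sd)).
have h2 := counting_vs_step s0 (ltn0Sn _) (ltW x0) sx.
have /andP[_ q2] := ratio_bounds s0.
have h3 : `|s * series u (Num.truncn x).+1 - s * limn (series (step_term M s))| <= 2.
  rewrite -mulrBr normrM (ger0_norm (ltW s0)).
  by apply: (@le_trans _ _ (s / (1 - expR (- s)))); [rewrite ler_pM2l|lra].
have h4 : `|harmonic_sum M - ln M%:R| <= 1.
  have b1 := harmonic_sum_le_ln (Num.truncn (expR (K / e))).
  have b2 := ln_le_harmonic_sum M.
  have b3 : ln M%:R <= ln M.+1%:R :> R by rewrite ler_ln ?posrE// ler_nat.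
  by rewrite -/M in b1; rewrite ler_norml; apply/andP; split; lra.
have h5 : `|alpha * ln M%:R - s * series u (Num.truncn x).+1| <= K.
  have -> : alpha * ln M%:R - s * series u (Num.truncn x).+1 =
    (alpha * harmonic_sum M - s * limn (series (step_term M s)))
    - (s * series u (Num.truncn x).+1 - s * limn (series (step_term M s)))
    - alpha * (harmonic_sum M - ln M%:R) by ring.
  apply: (le_trans (ler_normB _ _)); rewrite normrM.
  have := ler_wpM2l (normr_ge0 alpha) h4.
  have := le_trans (ler_normB _ _) (lerD h1 h3).
  by rewrite /K; lra.
have -> : alpha - series u (Num.truncn x).+1 / x =
    (alpha * ln M%:R - s * series u (Num.truncn x).+1) / ln M%:R.
  by rewrite /s; field; rewrite !gt_eqF.
rewrite normrM normfV (ger0_norm (ltW lnM0)) ler_pdivrMr// (le_trans h5)//.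
by rewrite mulrC -ler_pdivrMr.
Unshelve. all: by end_near. Qed.

End Tauberian.

(** * Partitions as multisets *)

Section Partitions.
Implicit Types (A B : set nat) (m : multiset nat).

Lemma sum_msetD m1 m2 :
  (\sum_(k <- msetD m1 m2) k = \sum_(k <- m1) k + \sum_(k <- m2) k)%N.
Proof.
rewrite -big_cat; apply: perm_big; apply/allP => a _ /=.
by rewrite count_cat !count_mem_mset msetE2.
Qed.

Lemma sum_mset1 a : (\sum_(k <- msetn 1 a) k = a)%N.
Proof. by rewrite enum_msetn /= big_seq1. Qed.

Lemma msetD_inj m : injective (msetD m).
Proof.
move=> m1 m2 /msetP E; apply/msetP => a; have := E a.
by rewrite !msetE2 => /addnI.
Qed.

Lemma partitions_part_le A n m k : partitions A n m -> k \in m -> (k <= n)%N.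
Proof.
move=> [_ <-] km; rewrite -[in leqRHS](msetB1K km) sum_msetD sum_mset1.
exact: leq_addr.
Qed.

Lemma eq_partition_count A B n :
  (forall k, (k <= n)%N -> A k <-> B k) -> partition_count A n = partition_count B n.
Proof.
move=> AB; rewrite /partition_count; congr (#|` fset_set _|%fset).
apply/seteqP; split=> m mP; split; try by case: mP.
- by move=> k km; apply/AB; [exact: partitions_part_le mP km|case: mP => + _; exact].
- by move=> k km; apply/AB; [exact: partitions_part_le mP km|case: mP => + _; exact].
Qed.

Lemma partition_count_set0 n : partition_count set0 n = (n == 0)%N.
Proof.
have E m : (forall k, k \in m -> set0 k) -> m = mset0.
  move=> mP; apply/msetP => k; rewrite mset0E; apply/mset_eq0P/negP; exact: mP.
rewrite /partition_count; case: n => [|n].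
  rewrite [X in fset_set X](_ : _ = [set mset0]) ?fset_set1 ?cardfs1//.
  apply/seteqP; split=> m; first by move=> [/E].
  by move=> ->; split=> [k|]; rewrite ?in_mset0// big_mset0.
rewrite [X in fset_set X](_ : _ = set0) ?fset_set0 ?cardfs0//.
by apply/seteqP; split=> m // [/E ->]; rewrite big_mset0.
Qed.

Lemma partition_count0 A : (forall k, A k -> (0 < k)%N) -> partition_count A 0 = 1%N.
Proof.
move=> A0; rewrite (@eq_partition_count _ set0) ?partition_count_set0// => k.
by rewrite leqn0 => /eqP ->; split=> // /A0.
Qed.

(** Sort the partitions by whether [a] occurs; removing one [a] is a
    bijection in the second case. *)
Lemma partition_count_rec A a n : (forall k, A k -> (0 < k)%N) -> A a ->
  partition_count A n = (partition_count (A `\ a) n +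
    (if a <= n then partition_count A (n - a) else 0))%N.
Proof.
move=> A0 Aa.
have AD0 k : (A `\ a) k -> (0 < k)%N by move=> [/A0].
have finA l := partitions_finite l A0.
have finD l := partitions_finite l AD0.
have split : partitions A n = partitions (A `\ a) n `|`
    [set m | partitions A n m /\ a \in m].
  apply/seteqP; split=> m.
    move=> mP; have [am|am] := boolP (a \in m); first by right.
    left; case: mP => mA ms; split=> // k km; split; first exact: mA.
    by move=> /= ka; rewrite -ka km in am.
  by move=> [[mA ms]|[//]]; split=> // k /mA[].
have fin2 : finite_set [set m | partitions A n m /\ a \in m].
  by apply: sub_finite_set (finA n) => m [].
rewrite [in LHS]/partition_count split fset_setU// cardfsU.
rewrite [X in (_ - #|` X|)%N](_ : _ = fset0) ?cardfs0 ?subn0; last first.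
  apply/fsetP => m; rewrite !inE !in_fset_set//; apply/negP => /andP[].
  by move=> /set_mem[mA _] /set_mem[_ /mA[_]]; exact.
congr (_ + _)%N; case: ifPn => an; last first.
  rewrite [X in fset_set X](_ : _ = set0) ?fset_set0 ?cardfs0//.
  by apply/seteqP; split=> m // [mP /(partitions_part_le mP)]; rewrite (negbTE an).
rewrite [X in fset_set X](_ : _ = msetD (msetn 1 a) @` partitions A (n - a)).
  rewrite fset_set_image// card_imfset//; exact: msetD_inj.
apply/seteqP; split=> m.
  move=> [[mA ms] am]; exists (msetB m (msetn 1 a)); last exact: msetB1K.
  split=> [k|]; first by rewrite in_msetB1 => /andP[_ /mA].
  by rewrite -ms -[in RHS](msetB1K am) sum_msetD sum_mset1 addKn.
move=> [m' [mA ms] <-]; split; last by rewrite in_msetD in_mset1 eqxx.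
split=> [k|]; first by rewrite in_msetD in_mset1 => /orP[/eqP ->|/mA].
by rewrite sum_msetD sum_mset1 ms subnKC.
Qed.

(** Adjoining a fixed partition of [d] is injective. *)
Lemma partition_count_leD A n d : (forall k, A k -> (0 < k)%N) ->
  (0 < partition_count A d)%N ->
  (partition_count A n <= partition_count A (n + d))%N.
Proof.
move=> A0; rewrite cardfs_gt0 => /fset0Pn[p].
rewrite in_fset_set; last exact: partitions_finite.
move=> /set_mem[pA ps]; rewrite /partition_count.
have <- : #|` (msetD p @` fset_set (partitions A n))%fset|%fset =
    #|` fset_set (partitions A n)|%fset.
  by rewrite card_imfset//; exact: msetD_inj.
apply: fsubset_leq_card; apply/fsubsetP => q /imfsetP[r /= + ->].
rewrite !in_fset_set; [|exact: partitions_finite..].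
move=> /set_mem[rA rs]; apply/mem_set; split=> [k|].
  by rewrite in_msetD => /orP[/pA|/rA].
by rewrite sum_msetD ps rs addnC.
Qed.

Lemma partition_count_gt0 A n m : (forall k, A k -> (0 < k)%N) ->
  partitions A n m -> (0 < partition_count A n)%N.
Proof.
move=> A0 mP; rewrite cardfs_gt0; apply/fset0Pn; exists m.
by rewrite in_fset_set; [exact/mem_set|exact: partitions_finite].
Qed.

(** The representable numbers form a subsemigroup; its least positive
    difference [d] divides every element of [A], hence is 1, and then two
    consecutive representable numbers [a] and [a + 1] generate everything from
    [a ^ 2] on. *)
Lemma partition_count_eventually_gt0 A : (forall k, A k -> (0 < k)%N) ->
  is_gcd A 1 ->
  exists N, forall n, (N <= n)%N -> (0 < partition_count A n)%N.
Proof.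
move=> A0 [_ gA].
pose S n := (0 < partition_count A n)%N.
have SD i j : S i -> S j -> S (i + j)%N.
  by move=> Si Sj; apply: leq_trans Si _; exact: partition_count_leD.
have S0 : S 0%N by rewrite /S partition_count0.
have SA k : A k -> S k.
  move=> Ak; apply: (@partition_count_gt0 _ _ (msetn 1 k)) => //; split=> [j|].
    by rewrite in_mset1 => /eqP ->.
  exact: sum_mset1.
have SM n q : S n -> S (q * n)%N.
  by move=> Sn; elim: q => [|q IH]; rewrite ?mul0n// mulSn; exact: SD.
pose D d := `[< (0 < d)%N /\ exists2 x, S x & S (x + d)%N >].
have [d0 Dd0] : exists d, D d.
  have [[k Ak]|nA] := pselect (exists k, A k).
    by exists k; apply/asboolP; split; [exact: A0|exists 0%N => //; exact: SA].
  have : (2 %| 1)%N by apply: gA => k Ak; case: nA; exists k.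
  by [].
have [d /asboolP[d_gt0 [x Sx Sxd]] dmin] := ex_minnP (ex_intro _ d0 Dd0).
have d1 : d = 1%N.
  apply/eqP; rewrite -dvdn1; apply: gA => k Ak.
  rewrite /dvdn; apply/negPn/negP; rewrite -lt0n => r0.
  have : D (k %% d)%N.
    apply/asboolP; split => //; exists (k %/ d * (x + d))%N; first exact: SM.
    rewrite mulnDr -addnA -divn_eq addnC; apply: SD; [exact: SA|exact: SM].
  by move/dmin; rewrite leqNgt ltn_mod d_gt0.
rewrite d1 addn1 in Sxd.
exists (x * x)%N => n xn.
have [x0|x0] := posnP x.
  by rewrite x0 in Sxd; rewrite -[n]muln1; exact: SM.
have rq : (n %% x <= n %/ x)%N.
  by rewrite (leq_trans (ltnW (ltn_pmod n x0)))// leq_divRL.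
have -> : n = ((n %/ x - n %% x) * x + n %% x * x.+1)%N.
  by rewrite mulnS addnCA -mulnDl subnK// addnC -divn_eq.
by apply: SD; exact: SM.
Qed.

End Partitions.

(** * The product formula for the generating function *)

Section GeneratingFunction.
Context {R : realType}.
Implicit Types (s z y : R).

Let partial_log n (x : R) : R := \sum_(0 <= k < n) k.+1%:R^-1 * x ^+ k.+1.

Let is_derive_partial_log n (x : R) :
  is_derive x 1 (partial_log n) (\sum_(0 <= k < n) x ^+ k).
Proof.
elim: n => [|n IH].
  rewrite (_ : partial_log 0 = cst 0); last by apply/funext => t; rewrite /partial_log big_geq.
  by rewrite big_geq//; exact: is_derive_cst.
rewrite (_ : partial_log n.+1 = partial_log n + (n.+1%:R^-1 \*: (id ^+ n.+1))); last first.
  by apply/funext => t; rewrite addrfctE /= exprfctE /partial_log big_nat_recr.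
rewrite big_nat_recr//=; apply: is_deriveD.
have h := is_deriveX n.+1 (is_derive_id x (1 : R)).
have := is_deriveZ n.+1%:R^-1 h.
rewrite (_ : _ *: _ = x ^+ n)//.
by rewrite /GRing.scale/= mulr1 mulrA mulVf ?mul1r.
Qed.

Let is_derive_log_remainder n (x : R) : x < 1 ->
  is_derive x 1 (fun t => - ln (1 - t) - partial_log n t) (x ^+ n / (1 - x)).
Proof.
move=> x1; have x10 : 0 < 1 - x by rewrite subr_gt0.
have -> : x ^+ n / (1 - x) = (1 - x)^-1 - \sum_(0 <= k < n) x ^+ k.
  have := @geometric_seriesE R 1 x; rewrite lt_eqF// => /(_ isT)/(congr1 (fun f => f n)).
  rewrite /series/=; under eq_bigr do rewrite mul1r.
  by move=> ->; field; rewrite gt_eqF.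
apply: is_deriveB; last exact: is_derive_partial_log.
have h1 : is_derive x 1 (fun t : R => 1 - t) (- 1).
  by rewrite -[X in is_derive _ _ _ X]sub0r; apply: is_deriveB.
have h2 : is_derive (1 - x) 1 (@ln R) (1 - x)^-1 by exact: is_derive1_ln.
have h3 := @is_derive1_comp R (@ln R) (fun t => 1 - t) x _ _ h2 h1.
have := is_deriveN h3.
by rewrite mulrN1 opprK.
Qed.

(** By the mean value theorem the remainder is [c^n / (1 - c) * z] for some
    [0 < c < z], the derivative of the remainder being [x^n / (1 - x)]. *)
Lemma cvg_log_series z : 0 <= z -> z < 1 ->
  series (fun k => k.+1%:R^-1 * z ^+ k.+1) @ \oo --> - ln (1 - z).
Proof.
move=> z0 z1.
have rem n : 0 <= - ln (1 - z) - partial_log n z <= z ^+ n * (z / (1 - z)).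
  have [->|zn0] := eqVneq z 0.
    rewrite subr0 ln1 oppr0 /partial_log big1 => [|k _]; last by rewrite expr0n/= mulr0.
    by rewrite subrr lexx mul0r mulr0 lexx.
  have zp : 0 < z by rewrite lt_neqAle eq_sym zn0.
  pose rem t := - ln (1 - t) - partial_log n t.
  have der t : t \in `]0, z[ -> is_derive t 1 rem (t ^+ n / (1 - t)).
    rewrite in_itv/= => /andP[_ tz]; apply: is_derive_log_remainder.
    exact: lt_trans z1.
  have cont : {within `[0, z], continuous rem}.
    apply: derivable_within_continuous => t; rewrite in_itv/= => /andP[_ tz].
    by have := @is_derive_log_remainder n t (le_lt_trans tz z1); case.
  have [c] := MVT zp der cont; rewrite in_itv/= => /andP[c0 cz].
  rewrite {2}/rem subr0 ln1 oppr0 /partial_log big1 => [|k _]; last by rewrite expr0n/= mulr0.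
  rewrite !subr0 ?addr0 -/(partial_log n z) => E; rewrite -/(rem z) E.
  have c1 : 0 < 1 - c by rewrite subr_gt0 (lt_trans cz).
  have z1' : 0 < 1 - z by rewrite subr_gt0.
  have cn : 0 <= c ^+ n by rewrite exprn_ge0// ltW.
  have cz0 : 0 <= c ^+ n / (1 - c) * z.
    by rewrite !mulr_ge0// invr_ge0 ltW.
  rewrite cz0/= -mulrA; apply: ler_pM => //; first by rewrite mulr_ge0 ?invr_ge0 ?ltW.
    by rewrite lerXn2r ?nnegrE ?(ltW c0)// ltW.
  by rewrite mulrC ler_wpM2l// lef_pV2 ?posrE// lerB// ltW.
apply/cvgrPdist_le => e e0.
have : (fun n => z ^+ n * (z / (1 - z))) @ \oo --> 0.
  rewrite -(mul0r (z / (1 - z))); apply: cvgMr_tmp; apply: cvg_expr.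
  by rewrite ger0_norm.
move/cvgrPdist_le => /(_ e e0); apply: filterS => n.
have /andP[r0 r1] := rem n; rewrite sub0r normrN => h.
rewrite /series/= -/(partial_log n z) ger0_norm//.
by apply: (le_trans r1); apply: le_trans h; exact: ler_norm.
Qed.

(** In terms of power series the recursion is [Q(y) = P(y) + y^a Q(y)]. As all terms
    are nonnegative, it also bounds the partial sums of [Q], which gives the
    convergence. *)
Lemma cvg_add_part (P Q : nat -> R) a y (L : R) : 0 < y -> y < 1 -> (0 < a)%N ->
  (forall k, 0 <= P k) -> (forall k, 0 <= Q k) ->
  (forall k, Q k = P k + (if (a <= k)%N then Q (k - a)%N else 0)) ->
  series (fun k => P k * y ^+ k) @ \oo --> L ->
  series (fun k => Q k * y ^+ k) @ \oo --> L / (1 - y ^+ a).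
Proof.
move=> y0 y1 a0 P0 Q0 QE PL.
have ya : 0 < 1 - y ^+ a by rewrite subr_gt0 exprn_ilt1 ?(ltW y0)// -lt0n.
have tP k : 0 <= P k * y ^+ k by rewrite mulr_ge0// exprn_ge0// ltW.
have tQ k : 0 <= Q k * y ^+ k by rewrite mulr_ge0// exprn_ge0// ltW.
have SE n : series (fun k => Q k * y ^+ k) (n + a)%N =
    series (fun k => P k * y ^+ k) (n + a)%N + y ^+ a * series (fun k => Q k * y ^+ k) n.
  rewrite {1}/series/=.
  rewrite (eq_bigr (fun k => P k * y ^+ k +
    (if (a <= k)%N then Q (k - a)%N else 0) * y ^+ k)); last first.
    by move=> k _; rewrite {1}QE mulrDl.
  rewrite big_split/=; congr (_ + _).
  rewrite (big_cat_nat (n := a)) ?leq_addl//= [X in X + _]big_nat big1 => [|k /andP[_ ka]]; last first.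
    by rewrite leqNgt ka mul0r.
  rewrite add0r -{1}[a]add0n big_addn addnK big_distrr/=; apply: eq_bigr => k _.
  by rewrite leq_addl addnK exprD; ring.
have cP : cvgn (series (fun k => P k * y ^+ k)) by exact: cvgP PL.
have SL n : series (fun k => P k * y ^+ k) n <= L.
  by rewrite -(cvg_lim _ PL)//; exact: series_le_lim.
have cQ : cvgn (series (fun k => Q k * y ^+ k)).
  apply: (bounded_series_cvg (M := L / (1 - y ^+ a))) => // n.
  rewrite ler_pdivlMr//.
  have h1 : series (fun k => Q k * y ^+ k) n <= series (fun k => Q k * y ^+ k) (n + a)%N.
    by apply: nondecreasing_series => //; rewrite leq_addr.
  by rewrite SE in h1; have := SL (n + a)%N; lra.
have QL := cQ; set l := limn _ in QL.
suff -> : L / (1 - y ^+ a) = l by [].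
have c1 : series (fun k => Q k * y ^+ k) (n + a)%N @[n --> \oo] --> l.
  by rewrite (cvg_shiftn a (series _)).
have c2 : series (fun k => Q k * y ^+ k) (n + a)%N @[n --> \oo] --> L + y ^+ a * l.
  under eq_fun do rewrite SE.
  by apply: cvgD; [rewrite (cvg_shiftn a (series _))|exact: cvgMl_tmp].
have E : l = L + y ^+ a * l by exact: (cvg_unique _ c1 c2).
have -> : L = l * (1 - y ^+ a) by lra.
by rewrite mulfK// gt_eqF.
Qed.

Variable A : set nat.
Hypothesis A0 : forall k, A k -> (0 < k)%N.

Let chi : nat -> R := \1_A.

Lemma indic_ge0 k : 0 <= \1_A k :> R.
Proof. by rewrite indicE. Qed.

Lemma indic_le1 k : \1_A k <= 1 :> R.
Proof. by rewrite indicE; case: (k \in A). Qed.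

Lemma indic_parts0 : \1_A 0%N = 0 :> R.
Proof. by rewrite indicE memNset// => /A0. Qed.

Let upto N := [set k | A k /\ (k <= N)%N].

Let upto_gt0 N k : upto N k -> (0 < k)%N.
Proof. by move=> [/A0]. Qed.

Let partial_logF s N := series (fun a => chi a * - ln (1 - expR (- s) ^+ a)) N.

Let cvg_gf_upto s N : 0 < s ->
  series (fun k => (partition_count (upto N) k)%:R * expR (- s) ^+ k) @ \oo -->
  expR (partial_logF s N.+1).
Proof.
move=> s0; set y := expR (- s).
have y0 : 0 < y by exact: expR_gt0.
have y1 : y < 1 by exact: expRN_lt1.
elim: N => [|N IH].
  rewrite /partial_logF /series/= big_nat1 /chi indic_parts0 mul0r expR0.
  rewrite [X in X @ _ --> _](_ : _ = fun n => (0 < n)%N%:R); last first.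
    apply/funext => -[|n]; first by rewrite big_geq.
    rewrite big_nat_recl//= big1 => [|k _].
      by rewrite addr0 partition_count0 ?mul1r//; exact: upto_gt0.
    rewrite (@eq_partition_count _ set0) ?partition_count_set0 ?mul0r// => j _.
    by split=> // -[/A0 jp j0]; rewrite leqNgt jp in j0.
  by apply: cvg_near_cst; near=> n; rewrite (_ : (0 < n)%N) //; near: n; exact: nbhs_infty_gt.
rewrite /partial_logF seriesSr -/(partial_logF s N.+1) -/y.
have uptoD : upto N.+1 `\ N.+1 = upto N.
  apply/seteqP; split=> k /=.
    by move=> [[Ak kN] kn]; split => //; rewrite -ltnS ltn_neqAle kN andbT; exact/eqP.
  by move=> [Ak kN]; split; [split => //; exact: leqW|move=> kE; rewrite kE ltnn in kN].
rewrite /chi indicE; have [/set_mem AN|/negP nAN] := boolP (N.+1 \in A); last first.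
  rewrite mul0r addr0 (_ : upto N.+1 = upto N)//.
  rewrite -uptoD; apply/seteqP; split=> k; last by case.
  by move=> kU; split=> // kE; apply: nAN; rewrite -kE; apply/mem_set; case: kU.
have yN : 0 < 1 - y ^+ N.+1 by rewrite subr_gt0 exprn_ilt1 ?(ltW y0).
rewrite mul1r expRD expRN lnK ?posrE//.
apply: (cvg_add_part (P := fun k => (partition_count (upto N) k)%:R)) => // k.
rewrite (@partition_count_rec _ N.+1)//; last exact: upto_gt0.
  by rewrite uptoD natrD; case: ifP.
Unshelve. all: by end_near. Qed.

Let gf_upto_le N k : (partition_count (upto N) k <= partition_count A k)%N.
Proof.
apply: fsubset_leq_card; apply/fsubsetP => m.
have fU := partitions_finite k (@upto_gt0 N); have fA := partitions_finite k A0.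
rewrite !in_fset_set// => /set_mem[mU ms]; apply/mem_set; split=> // j /mU.
by case.
Qed.

(** Truncating the set of parts at [N] does not change the coefficients up to
    [N], so the truncated products bound the partial sums from above, and are
    themselves bounded by the whole series. *)
Lemma cvg_gf s (l : R) : 0 < s ->
  series (fun a => chi a * - ln (1 - expR (- s) ^+ a)) @ \oo --> l ->
  series (fun k => (partition_count A k)%:R * expR (- s) ^+ k) @ \oo --> expR l.
Proof.
move=> s0 cl; set y := expR (- s).
have y0 : 0 < y by exact: expR_gt0.
have y1 : y < 1 by exact: expRN_lt1.
have log0 a : 0 <= chi a * - ln (1 - y ^+ a).
  by rewrite mulr_ge0 ?indic_ge0// oppr_ge0 ln_le0// gerBl exprn_ge0// ltW.
have lb N : partial_logF s N <= l.
  rewrite -(cvg_lim _ cl)//; apply: series_le_lim => //; exact: cvgP cl.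
have t0 (q : nat -> nat) k : 0 <= (q k)%:R * y ^+ k by rewrite mulr_ge0// exprn_ge0// ltW.
pose F := series (fun k => (partition_count A k)%:R * y ^+ k).
have Fl n : F n <= expR l.
  apply: (@le_trans _ _ (expR (partial_logF s n.+1))); last by rewrite ler_expR.
  have cU := @cvg_gf_upto s n s0.
  rewrite -(cvg_lim _ cU)//; apply: le_trans (series_le_lim n (t0 _) (cvgP _ cU)).
  rewrite /F /series/= big_nat [leRHS]big_nat; apply: ler_sum => k /andP[_ kn].
  rewrite (@eq_partition_count _ (upto n))// => j jk; split; last by case.
  by move=> Aj; split=> //; apply: leq_trans jk (ltnW kn).
have cF : cvgn F by apply: bounded_series_cvg Fl; exact: t0.
suff <- : limn F = expR l by [].
apply/eqP; rewrite eq_le; apply/andP; split.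
  by apply: lim_series_le_bound => //; exact: Fl.
have lF N : expR (partial_logF s N.+1) <= limn F.
  have cU := @cvg_gf_upto s N s0; rewrite -(cvg_lim _ cU)//.
  apply: lim_series_le => // [|k]; first exact: cvgP cU.
  by rewrite ler_wpM2r ?exprn_ge0 ?(ltW y0)// ler_nat gf_upto_le.
have F0 : 0 < limn F by apply: lt_le_trans (lF 0%N); exact: expR_gt0.
rewrite -[leRHS]lnK ?posrE// ler_expR -(cvg_lim _ cl)//.
apply: limr_le; first exact: cvgP cl.
near=> n; have n0 : (0 < n)%N by near: n; exact: nbhs_infty_gt.
by rewrite -ler_expR lnK ?posrE//; have := lF n.-1; rewrite prednK.
Unshelve. all: by end_near. Qed.

(** Expanding the logarithms gives the double series of
    [chi a * y^(a k) / k]; it is summed over [a] first. *)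
Lemma cvg_log_gf s : 0 < s ->
  series (fun a => chi a * - ln (1 - expR (- s) ^+ a)) @ \oo -->
  log_mean chi s / s.
Proof.
move=> s0; set y := expR (- s).
have y0 : 0 < y by exact: expR_gt0.
have y1 : y < 1 by exact: expRN_lt1.
pose f N k := k.+1%:R * s * series (fun a => chi a * expR (- (k.+1%:R * s)) ^+ a) N.
have fN N : series (fun k => invsq k * f N k) @ \oo --> s * partial_logF s N.
  elim: N => [|N IH].
    rewrite /partial_logF /series/= big_geq// mulr0.
    rewrite (_ : (fun n => _) = fun=> 0); first exact: cvg_cst.
    by apply/funext => n; apply: big1 => k _; rewrite /f /series/= big_geq// !mulr0.
  have lN : series (fun k => s * (chi N * (k.+1%:R^-1 * (y ^+ N) ^+ k.+1))) @ \oo -->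
      s * (chi N * - ln (1 - y ^+ N)).
    have [->|N0] := posnP N.
      rewrite /chi indic_parts0 mul0r mulr0 (_ : series _ = fun=> 0); first exact: cvg_cst.
      by apply/funext => n; apply: big1 => k _; rewrite mul0r mulr0.
    have yN0 : 0 <= y ^+ N by rewrite exprn_ge0// ltW.
    have yN1 : y ^+ N < 1 by rewrite exprn_ilt1 ?(ltW y0)// -lt0n.
    have cl := cvg_log_series yN0 yN1.
    rewrite -(cvg_lim _ cl)// -!lim_series_scale; first last.
    - exact: cvgP cl.
    - exact/is_cvg_series_scale/(cvgP _ cl).
    - exact/is_cvg_series_scale/is_cvg_series_scale/(cvgP _ cl).
  rewrite /partial_logF seriesSr -/(partial_logF s N) mulrDr.
  rewrite [X in X @ _ --> _](_ : _ = series (fun k => invsq k * f N k) +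
      series (fun k => s * (chi N * (k.+1%:R^-1 * (y ^+ N) ^+ k.+1)))).
    exact: cvgD IH lN.
  rewrite -seriesD; congr series; apply/funext => k /=; rewrite addrfctE.
  rewrite /f seriesSr !mulrDr; congr (_ + _).
  have -> : expR (- (k.+1%:R * s)) ^+ N = (y ^+ N) ^+ k.+1.
    by rewrite -mulrN expRM_natl exprAC.
  have : k.+1%:R != 0 :> R by rewrite pnatr_eq0.
  rewrite /invsq; move: (_ ^+ k.+1) (k.+1%:R) => z c c0.
  by field.
have lims : s * partial_logF s N @[N --> \oo] --> log_mean chi s.
  have -> : (fun N => s * partial_logF s N) = (fun N => limn (series (fun k => invsq k * f N k))).
    by apply/funext => N; rewrite (cvg_lim _ (fN N)).
  apply: (tannery (M := 1)) => [k|||k]; first exact: invsq_ge0.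
  - exact: cvg_series_invsq.
  - near=> N => k.
    have ks : 0 < k.+1%:R * s by rewrite mulr_gt0.
    have t0 a : 0 <= chi a * expR (- (k.+1%:R * s)) ^+ a.
      by rewrite mulr_ge0 ?indic_ge0// exprn_ge0// expR_ge0.
    rewrite /f ger0_norm; last first.
      by apply: mulr_ge0; [exact: ltW|exact: sumr_ge0].
    have /andP[_] := mean_bounds indic_parts0 indic_ge0 indic_le1 ks.
    apply: le_trans; rewrite /mean ler_pM2l//; apply: series_le_lim => //.
    exact: laplace_cvg indic_ge0 indic_le1 _ ks.
  - have ks : 0 < k.+1%:R * s by rewrite mulr_gt0.
    by apply: cvgMl_tmp; exact: laplace_cvg indic_ge0 indic_le1 _ ks.
rewrite mulrC (_ : series _ = fun N => s^-1 * (s * partial_logF s N)).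
  exact: cvgMl_tmp.
by apply/funext => N; rewrite mulKf// gt_eqF.
Unshelve. all: by end_near. Qed.

Lemma log_gf s : 0 < s ->
  cvgn (series (fun k => (partition_count A k)%:R * expR (- s) ^+ k)) /\
  s * ln (laplace (fun k => (partition_count A k)%:R) s) = log_mean chi s.
Proof.
move=> s0; have c := cvg_gf s0 (cvg_log_gf s0); split; first exact: cvgP c.
by rewrite /laplace (cvg_lim _ c)// expRK mulrC divfK// gt_eqF.
Qed.

End GeneratingFunction.

(** * From growth of coefficients to the Laplace transform *)

Section LaplaceGrowth.
Context {R : realType}.
Implicit Types (s : R).

Lemma ln1D_le_sqrt (u : R) : 0 <= u -> ln (1 + u) <= 2 * Num.sqrt u.
Proof.
move=> u0; have r0 := sqrtr_ge0 u.
have r1 : 0 < 1 + Num.sqrt u by rewrite ltr_pwDl.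
apply: (@le_trans _ _ (ln ((1 + Num.sqrt u) ^+ 2))).
  rewrite ler_ln ?posrE ?exprn_gt0 ?ltr_pwDl//.
  by rewrite sqrrD expr1n sqr_sqrtr//; lra.
rewrite lnXn// -(mulr_natl (ln _)) ler_wpM2l//; apply: le_ln1Dx; lra.
Qed.

(** The logarithm of the geometric series is negligible at the scale [1 / s]. *)
Lemma near_log_geometric_le (eta e : R) : 0 < eta -> 0 < e ->
  \forall s \near 0^'+, s * ln ((1 - expR (- (eta * s)))^-1) <= e.
Proof.
move=> eta0 e0; apply/near_at_right0P; exists (eta * (e / 2) ^+ 2).
  by rewrite mulr_gt0// exprn_gt0// divr_gt0.
move=> s /andP[s0 sd].
have es0 : 0 < eta * s by rewrite mulr_gt0.
have y1 : 0 < 1 - expR (- (eta * s)) by rewrite subr_gt0 expRN_lt1.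
have /andP[_ q] := ratio_bounds es0.
have h : (1 - expR (- (eta * s)))^-1 <= 1 + (eta * s)^-1.
  rewrite -(ler_pM2l es0) mulrDr mulr1 mulfV ?gt_eqF//.
  by move: q; lra.
have h1 : ln ((1 - expR (- (eta * s)))^-1) <= 2 * Num.sqrt (eta * s)^-1.
  apply: (le_trans _ (ln1D_le_sqrt _)); last by rewrite invr_ge0 ltW.
  by rewrite ler_ln ?posrE ?invr_gt0// addr_gt0// invr_gt0.
apply: (le_trans (ler_wpM2l (ltW s0) h1)).
have -> : s * (2 * Num.sqrt (eta * s)^-1) = 2 * Num.sqrt (s / eta).
  rewrite mulrCA; congr (_ * _).
  rewrite -[X in X * _](gtr0_norm s0) -sqrtr_sqr -sqrtrM ?sqr_ge0//; congr Num.sqrt.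
  by field; rewrite !gt_eqF.
rewrite mulrC -ler_pdivlMr// -[leRHS](@ger0_norm _ (e / 2)); last by rewrite divr_ge0// ltW.
by rewrite -sqrtr_sqr ler_wsqrtr// ler_pdivrMr// mulrC ltW.
Qed.

Variable p : nat -> R.
Hypothesis p_ge0 : forall n, 0 <= p n.
Hypothesis p_cvg : forall s, 0 < s -> cvgn (series (fun n => p n * expR (- s) ^+ n)).

Lemma term_le_laplace s n : 0 < s -> p n * expR (- s) ^+ n <= laplace p s.
Proof.
move=> s0.
have t0 k : 0 <= p k * expR (- s) ^+ k by rewrite mulr_ge0// exprn_ge0// expR_ge0.
apply: le_trans (series_le_lim n.+1 t0 (p_cvg s0)).
by rewrite seriesSr lerDr; exact: sumr_ge0.
Qed.

(** The saddle point upper bound: one term is at most the whole series. *)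
Lemma ln_term_le s n : 0 < s -> 0 < p n -> ln (p n) <= ln (laplace p s) + n%:R * s.
Proof.
move=> s0 pn0; have h := term_le_laplace n s0.
have y0 : 0 < expR (- s) ^+ n by rewrite exprn_gt0// expR_gt0.
have F0 : 0 < laplace p s by apply: lt_le_trans h; rewrite mulr_gt0.
have : ln (p n * expR (- s) ^+ n) <= ln (laplace p s).
  by rewrite ler_ln// posrE mulr_gt0.
rewrite lnM ?posrE// -expRM_natl expRK; lra.
Qed.

Lemma sqrtr_ratio_near (f : nat -> R) (b e : R) : 0 < b -> 0 < e ->
  f n / (2 * Num.sqrt (b * n%:R)) @[n --> \oo] --> (1 : R) ->
  \forall n \near \oo, (1 - e) * (2 * Num.sqrt (b * n%:R)) <= f n <=
    (1 + e) * (2 * Num.sqrt (b * n%:R)).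
Proof.
move=> b0 e0 /cvgrPdist_le/(_ e e0) h; near=> n.
have n0 : (0 < n)%N by near: n; exact: nbhs_infty_gt.
have D0 : 0 < 2 * Num.sqrt (b * n%:R).
  by rewrite mulr_gt0// sqrtr_gt0 mulr_gt0// ltr0n.
have : `|1 - f n / (2 * Num.sqrt (b * n%:R))| <= e by near: n.
rewrite ler_norml => /andP[h1 h2]; apply/andP; split.
  by rewrite -ler_pdivlMr//; lra.
by rewrite -ler_pdivrMr//; lra.
Unshelve. all: by end_near. Qed.

Section FromGrowth.
Variable b : R.
Hypotheses (b_gt0 : 0 < b) (p_nat : forall n, p n = 0 \/ 1 <= p n).
Hypothesis growth : ln (p n) / (2 * Num.sqrt (b * n%:R)) @[n --> \oo] --> (1 : R).

Let p_le_exp n : p n <= expR (ln (p n)).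
Proof.
have [->|p1] := p_nat n; first exact: expR_ge0.
by rewrite lnK// posrE (lt_le_trans ltr01).
Qed.

(** Keep only the term of index [n] near [b / s^2], where [2 sqrt (b n) - n s] is
    maximal. *)
Lemma near_log_laplace_ge e : 0 < e ->
  \forall s \near 0^'+, b - e <= s * ln (laplace p s).
Proof.
move=> e0; pose d := Num.min (1 / 4) (e / (4 * b)).
have d0 : 0 < d by rewrite lt_min !divr_gt0// mulr_gt0.
have d1 : d <= 1 / 4 by rewrite ge_min lexx.
have db : d * b <= e / 4.
  rewrite -ler_pdivlMr// (le_trans (_ : _ <= e / (4 * b)))//.
    by rewrite ge_min lexx orbT.
  by rewrite le_eqVlt; apply/orP; left; apply/eqP; field; rewrite gt_eqF.
have [N _ HN] := sqrtr_ratio_near b_gt0 d0 growth.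
apply/near_at_right0P.
exists (Num.min (Num.min 1 (e / 2)) (Num.sqrt (b / N.+1%:R))).
  by rewrite !lt_min ltr01 divr_gt0//= sqrtr_gt0 divr_gt0.
move=> s /andP[s0]; rewrite !lt_min => /andP[/andP[s1 se] sN].
pose n := Num.truncn (b / s ^+ 2).
have s2 : 0 < s ^+ 2 by rewrite exprn_gt0.
have nb : n%:R <= b / s ^+ 2 by rewrite truncn_le// divr_ge0// ltW.
have bn : b / s ^+ 2 < n.+1%:R by exact: truncnS_gt.
have Nn : (N < n)%N.
  rewrite truncn_ge_nat ?divr_ge0 ?(ltW s2) ?(ltW b_gt0)//.
  rewrite ler_pdivlMr// mulrC -ler_pdivlMr//.
  rewrite -[leRHS]sqr_sqrtr ?divr_ge0 ?(ltW b_gt0)//.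
  by rewrite lerXn2r ?nnegrE ?sqrtr_ge0 ?(ltW s0)// ltW.
have n0 : 0 < n%:R :> R by rewrite ltr0n (leq_ltn_trans _ Nn).
have /andP[h _] := HN n (ltnW Nn).
have pn0 : 0 < p n.
  have [pn|p1] := p_nat n; last exact: lt_le_trans p1.
  move: h; rewrite pn ln0// leNgt mulr_gt0 ?mulr_gt0 ?sqrtr_gt0 ?mulr_gt0//.
  by rewrite subr_gt0; lra.
have G := ln_term_le s0 pn0.
pose w := s * Num.sqrt n%:R.
have w0 : 0 <= w by rewrite mulr_ge0 ?sqrtr_ge0// ltW.
have w2 : w ^+ 2 = s ^+ 2 * n%:R by rewrite exprMn sqr_sqrtr.
have w2b : w ^+ 2 <= b by rewrite w2 mulrC -ler_pdivlMr.
have w2b' : b - s ^+ 2 <= w ^+ 2.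
  by move: bn; rewrite ltr_pdivrMr// -natr1 w2; lra.
have wb : w <= Num.sqrt b.
  by rewrite -[w]ger0_norm// -sqrtr_sqr ler_wsqrtr.
have h1 : (1 - d) * (2 * w ^+ 2) <= s * ln (p n).
  apply: le_trans (ler_wpM2l (ltW s0) h).
  rewrite sqrtrM ?(ltW b_gt0)//.
  have -> : s * ((1 - d) * (2 * (Num.sqrt b * Num.sqrt n%:R))) =
    (1 - d) * (2 * (w * Num.sqrt b)) by rewrite /w; ring.
  rewrite ler_wpM2l ?subr_ge0//; first lra.
  by rewrite ler_wpM2l// expr2 ler_wpM2l.
have h2 : s * ln (p n) <= s * ln (laplace p s) + w ^+ 2.
  by apply: (le_trans (ler_wpM2l (ltW s0) G)); rewrite w2 mulrDr; lra.
have h3 : d * w ^+ 2 <= e / 4 by apply: le_trans db; rewrite ler_wpM2l// ltW.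
have h4 : s ^+ 2 <= e / 2.
  by apply: le_trans (ltW se); rewrite expr2 ler_piMl ?(ltW s0)// ltW.
lra.
Qed.

(** With [th > 1] close to 1, [2 th sqrt (b n) <= th^3 b / s + n s / th] by the
    inequality of the means; the terms are thus dominated by a geometric series
    of ratio [exp (- (1 - 1 / th) s)]. *)
Lemma near_log_laplace_le e : 0 < e ->
  \forall s \near 0^'+, s * ln (laplace p s) <= b + e.
Proof.
move=> e0; pose d := Num.min 1 (e / (14 * b)).
have d0 : 0 < d by rewrite lt_min ltr01 divr_gt0// mulr_gt0.
have d1 : d <= 1 by rewrite ge_min lexx.
have db : d * b <= e / 14.
  rewrite -ler_pdivlMr// (le_trans (_ : _ <= e / (14 * b)))//.
    by rewrite ge_min lexx orbT.
  by rewrite le_eqVlt; apply/orP; left; apply/eqP; field; rewrite gt_eqF.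
pose th := 1 + d; have th0 : 0 < th by rewrite addr_gt0.
have th3 : th ^+ 3 * b <= b + e / 2.
  have dd : d * (d * b) <= d * b by rewrite ler_piMl// mulr_ge0// ltW.
  have ddd : d * (d * (d * b)) <= d * b.
    by apply: le_trans dd; rewrite ler_wpM2l ?(ltW d0)// ler_piMl// mulr_ge0// ltW.
  have -> : th ^+ 3 * b = b + 3 * (d * b) + 3 * (d * (d * b)) + d * (d * (d * b)).
    by rewrite /th; ring.
  lra.
have [N _ HN] := sqrtr_ratio_near b_gt0 d0 growth.
pose C := 1 + series p N.
have C1 : 1 <= C by rewrite lerDl; exact: sumr_ge0.
have C0 : 0 < C by exact: lt_le_trans C1.
have amgm s n : 0 < s -> th * (2 * Num.sqrt (b * n%:R)) <= th ^+ 3 * b / s + n%:R * s / th.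
  move=> s0; pose x := Num.sqrt b * th ^+ 2; pose z := Num.sqrt n%:R * s.
  have -> : th * (2 * Num.sqrt (b * n%:R)) = 2 * x * z / (s * th).
    by rewrite /x /z sqrtrM ?(ltW b_gt0)//; field; rewrite !gt_eqF.
  have -> : th ^+ 3 * b / s + n%:R * s / th = (x ^+ 2 + z ^+ 2) / (s * th).
    by rewrite /x /z !exprMn !sqr_sqrtr ?(ltW b_gt0)//; field; rewrite !gt_eqF.
  rewrite ler_pM2r ?invr_gt0 ?mulr_gt0//.
  by have := sqr_ge0 (x - z); rewrite sqrrB; lra.
have pbound s n : 0 < s -> p n <= C * (expR (th ^+ 3 * b / s) * expR (n%:R * s / th)).
  move=> s0; rewrite -expRD.
  have x0 : 0 <= th ^+ 3 * b / s + n%:R * s / th.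
    apply: le_trans (amgm s n s0); apply: mulr_ge0; first exact: ltW.
    by apply: mulr_ge0 => //; exact: sqrtr_ge0.
  have [nN|nN] := ltnP n N.
    apply: (@le_trans _ _ (C * 1)); last first.
      by apply: ler_wpM2l; [exact: ltW|rewrite -[leLHS]expR0 ler_expR].
    rewrite mulr1 /C ler_wpDl// /series/= (bigD1_seq n) ?iota_uniq ?mem_index_iota//=.
    by rewrite lerDl; exact: sumr_ge0.
  have /andP[_ h] := HN n nN.
  apply: (le_trans (p_le_exp n)); apply: (@le_trans _ _ (1 * expR (th ^+ 3 * b / s + n%:R * s / th))).
    by rewrite mul1r ler_expR (le_trans h)// amgm.
  by rewrite ler_wpM2r// expR_ge0.
pose eta := 1 - th^-1.
have eta0 : 0 < eta by rewrite subr_gt0 invf_lt1// ltrDl.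
have Fle s : 0 < s -> laplace p s <=
    C * expR (th ^+ 3 * b / s) * (1 - expR (- (eta * s)))^-1.
  move=> s0; apply: lim_series_le_bound; last exact: p_cvg.
  move=> n; have es0 : 0 < eta * s by rewrite mulr_gt0.
  apply: le_trans (ler_wpM2l _ (series_expr_le n (expR_ge0 _) (expRN_lt1 es0))).
    rewrite /series/= big_distrr/=; apply: ler_sum => k _.
    apply: (@le_trans _ _ (C * (expR (th ^+ 3 * b / s) * expR (k%:R * s / th)) * expR (- s) ^+ k)).
      by rewrite ler_wpM2r ?exprn_ge0 ?expR_ge0// pbound.
    rewrite -!mulrA ler_pM2l// ler_pM2l ?expR_gt0// -!expRM_natl -expRD ler_expR.
    by rewrite /eta le_eqVlt; apply/orP; left; apply/eqP; field; rewrite gt_eqF.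
  by rewrite mulr_ge0 ?expR_ge0// ltW.
have e4 : 0 < e / 4 by rewrite divr_gt0.
have hpos : \forall s \near 0^'+, 0 < laplace p s.
  have [n n1 pn] : exists2 n, (0 < n)%N & 0 < p n.
    have d20 : 0 < 1 / 2 :> R by rewrite divr_gt0.
    have [M _ HM] := sqrtr_ratio_near b_gt0 d20 growth.
    exists M.+1 => //; have /andP[h _] := HM M.+1 (leqnSn _).
    have [pn|p1] := p_nat M.+1; last exact: lt_le_trans p1.
    move: h; rewrite pn ln0// leNgt mulr_gt0 ?mulr_gt0 ?sqrtr_gt0 ?mulr_gt0//.
    by rewrite subr_gt0; lra.
  near=> s; have s0 : 0 < s by near: s; exact: near_at_right0_gt0.
  apply: lt_le_trans (term_le_laplace n s0).
  by rewrite mulr_gt0// exprn_gt0// expR_gt0.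
have lC : 0 < ln C + 1 by rewrite ltr_wpDl// ln_ge0.
near=> s.
have s0 : 0 < s by near: s; exact: near_at_right0_gt0.
have F0 : 0 < laplace p s by near: s.
have h1 : s * ln ((1 - expR (- (eta * s)))^-1) <= e / 4.
  by near: s; exact: near_log_geometric_le.
have h2 : s * ln C <= e / 4.
  apply: (@le_trans _ _ (s * (ln C + 1))); first by rewrite ler_pM2l// lerDl.
  rewrite -ler_pdivlMr//; near: s; apply/near_at_right0P.
  by exists (e / 4 / (ln C + 1)); [exact: divr_gt0|move=> t /andP[_ /ltW]].
have y1 : 0 < 1 - expR (- (eta * s)) by rewrite subr_gt0 expRN_lt1// mulr_gt0.
have : ln (laplace p s) <= ln C + th ^+ 3 * b / s + ln ((1 - expR (- (eta * s)))^-1).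
  have := Fle s s0; rewrite -ler_ln ?posrE//; last first.
    by rewrite !mulr_gt0 ?expR_gt0// invr_gt0.
  by rewrite !lnM ?posrE ?mulr_gt0 ?expR_gt0 ?invr_gt0// expRK.
move=> /(ler_wpM2l (ltW s0)); rewrite !mulrDr (_ : s * (th ^+ 3 * b / s) = th ^+ 3 * b).
  lra.
by field; rewrite gt_eqF.
Unshelve. all: by end_near. Qed.

Lemma cvg_log_laplace_of_growth : s * ln (laplace p s) @[s --> 0^'+] --> b.
Proof.
apply/cvgrPdist_le => e e0; near=> s.
have h1 : b - e <= s * ln (laplace p s) by near: s; exact: near_log_laplace_ge.
have h2 : s * ln (laplace p s) <= b + e by near: s; exact: near_log_laplace_le.
by rewrite ler_norml; apply/andP; split; lra.
Unshelve. all: by end_near. Qed.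

End FromGrowth.
End LaplaceGrowth.

(** * From the Laplace transform to growth of coefficients *)

Section GrowthFromLaplace.
Context {R : realType}.
Implicit Types (s : R).
(** The outer two terms are each at most [F / 3], because the weights
    [1 / (1 +- eta)] differ from [1 -+ eta] by [O(eta^2)] only; the third term
    is then at least [F / 3]. The value [eta = d / 4] minimizes the exponent
    [b (2 eta^2 - d eta) / s] of the second term relative to [F]. *)
Lemma three_ranges_arith (b d s F F1 F2 P g : R) :
  let eta := d / 4 in let kap := b * d ^+ 2 / 48 in
  let r1 := (1 - d) * b / s ^+ 2 in let r2 := (1 + d) * b / s ^+ 2 in
  0 < b -> 0 < d -> d <= 1 / 2 -> 0 < s -> s <= b * d ^+ 2 / 32 ->
  s * ln 3 <= b * d / 8 ->
  0 < F -> 0 < F1 -> 0 < F2 -> 0 < P -> 0 < g ->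
  `|b - s * ln F| <= kap ->
  `|b - (1 + eta) * s * ln F1| <= kap ->
  `|b - (1 - eta) * s * ln F2| <= kap ->
  s * ln g <= b * d / 8 ->
  F <= expR (r1 * (eta * s)) * F1 + expR (- (r2 * (eta * s))) * F2 +
    P * expR (- (r1 * (s - eta * s))) * g ->
  b * (2 - 2 * d) <= s * ln P.
Proof.
move=> eta kap r1 r2 b_gt0 d0 d1 s0 sb s3 F0 F10 F20 P0 g0 G G1 G2 hgeo H.
have eta0 : 0 < eta by rewrite divr_gt0.
have kap0 : 0 < kap by rewrite divr_gt0// mulr_gt0// exprn_gt0.
have eta1 : eta <= 1 / 8 by rewrite /eta; lra.
have e1 : 0 < 1 + eta by rewrite addr_gt0.
have e2 : 0 < 1 - eta by lra.
have small x t : 0 < t -> s * (x + ln t) <= s * ln F - b * d ^+ 2 / 16 ->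
    expR x * t <= F / 3.
  move=> t0 hx.
  have F3 : 0 < F / 3 by rewrite divr_gt0.
  rewrite -ler_ln ?posrE//; last by rewrite mulr_gt0 ?expR_gt0.
  rewrite lnM ?posrE ?expR_gt0// expRK ln_div ?posrE//.
  rewrite -(ler_pM2l s0); apply: (le_trans hx); rewrite mulrBr lerD2l lerN2.
  have l3 : ln 3 <= 2 :> R.
    have -> : 3 = 1 + 2 :> R by lra.
    by apply: le_ln1Dx; lra.
  apply: (@le_trans _ _ (s * 2)); first by rewrite ler_pM2l.
  lra.
have bd2 : 0 <= b * d ^+ 2 by rewrite mulr_ge0 ?sqr_ge0// ltW.
have be2 : b * eta * eta = b * d ^+ 2 / 16 by rewrite /eta; field.
have bde : b * d * eta = b * d ^+ 2 / 4 by rewrite /eta; field.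
have kapE : kap = b * d ^+ 2 / 48 by [].
move: G G1 G2; rewrite !ler_norml => /andP[Ga Gb] /andP[G1a G1b] /andP[G2a G2b].
have A1 : expR (r1 * (eta * s)) * F1 <= F / 3.
  apply: small => //.
  have -> : s * (r1 * (eta * s) + ln F1) =
      (1 - d) * b * eta + (1 + eta) * s * ln F1 / (1 + eta).
    by rewrite /r1; field; rewrite !gt_eqF// addr_gt0.
  have h : (1 + eta) * s * ln F1 / (1 + eta) <= b * (1 - eta + eta * eta) + kap.
    rewrite ler_pdivrMr//.
    have x1 : 0 <= kap * eta by rewrite mulr_ge0// ltW.
    have x2 : 0 <= b * eta * eta * eta by rewrite !mulr_ge0// ltW.
    by lra.
  by lra.
have A2 : expR (- (r2 * (eta * s))) * F2 <= F / 3.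
  apply: small => //.
  have -> : s * (- (r2 * (eta * s)) + ln F2) =
      - ((1 + d) * b * eta) + (1 - eta) * s * ln F2 / (1 - eta).
    by rewrite /r2; field; rewrite !gt_eqF.
  have h : (1 - eta) * s * ln F2 / (1 - eta) <= b * (1 + eta + 2 * (eta * eta)) + 2 * kap.
    rewrite ler_pdivrMr//.
    have x1 : 0 <= kap * (1 / 8 - eta) by rewrite mulr_ge0 ?(ltW kap0)// subr_ge0.
    have x2 : 0 <= b * eta * eta * (1 / 8 - eta).
      by rewrite mulr_ge0 ?subr_ge0// !mulr_ge0// ltW.
    by lra.
  by lra.
have A3 : F / 3 <= P * expR (- (r1 * (s - eta * s))) * g.
  by lra.
have : ln F - ln 3 <=
    ln P - r1 * (s - eta * s) + ln g.
  move: A3; rewrite -ler_ln ?posrE; last 2 first.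
  - by rewrite divr_gt0.
  - by rewrite !mulr_gt0// expR_gt0.
  rewrite ln_div ?posrE// !lnM ?posrE ?mulr_gt0 ?expR_gt0// expRK.
  by [].
move=> /(ler_wpM2l (ltW s0)).
have -> : s * (ln P - r1 * (s - eta * s) + ln g) =
    s * ln P - (1 - d) * b * (1 - eta) + s * ln g.
  by rewrite /r1; field; rewrite gt_eqF.
rewrite mulrBr => K.
have kd : kap <= b * d / 96.
  have : b * d * d <= b * d * (1 / 2) by rewrite ler_wpM2l// mulr_ge0// ltW.
  by rewrite kapE expr2; lra.
have be : b * eta = b * d / 4 by rewrite /eta; field.
have bde0 : 0 <= b * d * eta by rewrite !mulr_ge0// ltW.
by lra.
Qed.


Variables (p : nat -> R) (b : R).
Hypotheses (p_ge0 : forall n, 0 <= p n) (p0 : p 0%N = 1).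
Hypothesis p_cvg : forall s, 0 < s -> cvgn (series (fun n => p n * expR (- s) ^+ n)).
Hypotheses (b_gt0 : 0 < b) (log_F : s * ln (laplace p s) @[s --> 0^'+] --> b).

Let F_ge1 s : 0 < s -> 1 <= laplace p s.
Proof.
by move=> s0; have := term_le_laplace p_ge0 p_cvg 0 s0; rewrite p0 expr0 mulr1.
Qed.

Let F_gt0 s : 0 < s -> 0 < laplace p s.
Proof. by move=> s0; apply: lt_le_trans (F_ge1 s0). Qed.

Lemma lim_series_le3 (u v1 v2 v3 : nat -> R) a1 a2 a3 :
  cvgn (series u) -> cvgn (series v1) -> cvgn (series v2) -> cvgn (series v3) ->
  (forall k, u k <= a1 * v1 k + a2 * v2 k + a3 * v3 k) ->
  limn (series u) <=
  a1 * limn (series v1) + a2 * limn (series v2) + a3 * limn (series v3).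
Proof.
move=> cu c1 c2 c3 h.
have d1 := @is_cvg_series_scale _ _ a1 c1; have d2 := @is_cvg_series_scale _ _ a2 c2.
have d3 := @is_cvg_series_scale _ _ a3 c3; have d12 := is_cvg_series_add d1 d2.
rewrite -(lim_series_scale a1 c1) -(lim_series_scale a2 c2) -(lim_series_scale a3 c3).
rewrite -(lim_series_add d1 d2) -(lim_series_add d12 d3).
exact: lim_series_le cu (is_cvg_series_add d12 d3) h.
Qed.

(** Chernoff bounds: the terms below [r1] are dominated by those at the larger
    argument [t1], the terms above [r2] by those at the smaller [t2], and the
    others, where [p k <= P], by a geometric series. *)
Lemma laplace_three_ranges s t1 t2 c r1 r2 P :
  s < t1 -> 0 < t2 -> t2 < s -> 0 < c -> c < s -> 0 <= P ->
  (forall k, k%:R <= r2 -> p k <= P) ->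
  laplace p s <= expR (r1 * (t1 - s)) * laplace p t1 +
    expR (- (r2 * (s - t2))) * laplace p t2 +
    P * expR (- (r1 * (s - c))) * (1 - expR (- c))^-1.
Proof.
move=> st1 t20 t2s c0 cs P0 pP.
have s0 : 0 < s by exact: lt_trans t2s.
have t10 : 0 < t1 by exact: lt_trans st1.
have cgeo : series (fun k => expR (- c) ^+ k) @ \oo --> (1 - expR (- c))^-1.
  have := @cvg_geometric_series R 1 (expR (- c)).
  rewrite ger0_norm ?expR_ge0// mul1r => /(_ (expRN_lt1 c0)).
  by rewrite (_ : geometric 1 _ = fun k => expR (- c) ^+ k)//; apply/funext => k /=; rewrite mul1r.
have <- := cvg_lim (@Rhausdorff R) cgeo.
apply: lim_series_le3; [exact: p_cvg|exact: p_cvg|exact: p_cvg|exact: cvgP cgeo|].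
move=> k; have pk := p_ge0 k; have k0 : 0 <= k%:R :> R by [].
have a1 : 0 <= expR (r1 * (t1 - s)) * (p k * expR (- t1) ^+ k).
  by rewrite !mulr_ge0 ?expR_ge0// exprn_ge0// expR_ge0.
have a2 : 0 <= expR (- (r2 * (s - t2))) * (p k * expR (- t2) ^+ k).
  by rewrite !mulr_ge0 ?expR_ge0// exprn_ge0// expR_ge0.
have a3 : 0 <= P * expR (- (r1 * (s - c))) * expR (- c) ^+ k.
  by rewrite !mulr_ge0 ?expR_ge0// exprn_ge0// expR_ge0.
have [kr1|kr1] := leP k%:R r1.
  apply: (@le_trans _ _ (expR (r1 * (t1 - s)) * (p k * expR (- t1) ^+ k))); last by lra.
  rewrite mulrCA ler_wpM2l// -!expRM_natl -expRD ler_expR.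
  by have : k%:R * (t1 - s) <= r1 * (t1 - s); [rewrite ler_wpM2r// subr_ge0 ltW|lra].
have [kr2|kr2] := leP k%:R r2.
  apply: (@le_trans _ _ (P * expR (- (r1 * (s - c))) * expR (- c) ^+ k)); last by lra.
  apply: (@le_trans _ _ (P * expR (- s) ^+ k)).
    by rewrite ler_wpM2r ?pP// exprn_ge0// expR_ge0.
  rewrite -mulrA ler_wpM2l// -!expRM_natl -expRD ler_expR.
  by have : r1 * (s - c) <= k%:R * (s - c); [rewrite ler_wpM2r ?subr_ge0 ?ltW|lra].
apply: (@le_trans _ _ (expR (- (r2 * (s - t2))) * (p k * expR (- t2) ^+ k))); last by lra.
rewrite mulrCA ler_wpM2l// -!expRM_natl -expRD ler_expR.
by have : r2 * (s - t2) <= k%:R * (s - t2); [rewrite ler_wpM2r ?subr_ge0 ?ltW|lra].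
Qed.

(** [laplace p s] is carried by the [k] near [b / s^2]: with the tilts
    [t = (1 +- d / 4) s] the two outer ranges are smaller than the whole by a
    factor [exp (- b d^2 / (16 s))]. *)
Lemma near_saddle (d : R) : 0 < d -> d <= 1 / 2 ->
  \forall s \near 0^'+, forall P,
    (forall k, k%:R <= (1 + d) * b / s ^+ 2 -> p k <= P) ->
    b * (2 - 2 * d) <= s * ln P.
Proof.
move=> d0 d1.
pose eta := d / 4; have eta0 : 0 < eta by rewrite divr_gt0.
pose kap := b * d ^+ 2 / 48; have kap0 : 0 < kap.
  by rewrite divr_gt0// mulr_gt0// exprn_gt0.
have e1 : 0 < 1 + eta by rewrite addr_gt0.
have e2 : 0 < 1 - eta by rewrite /eta; lra.
have /near_at_right0P[dG dG0 HG] : \forall s \near 0^'+, `|b - s * ln (laplace p s)| <= kap.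
  by move/cvgrPdist_le : log_F; apply.
have bd0 : 0 < b * d / 8 by rewrite divr_gt0// mulr_gt0.
near=> s.
have s0 : 0 < s by near: s; exact: near_at_right0_gt0.
have sG : s < dG / (1 + eta).
  near: s; apply/near_at_right0P; exists (dG / (1 + eta)); first exact: divr_gt0.
  by move=> t /andP[].
have hgeo : s * ln ((1 - expR (- (eta * s)))^-1) <= b * d / 8.
  by near: s; exact: near_log_geometric_le.
have sb : s <= b * d ^+ 2 / 32.
  near: s; apply/near_at_right0P; exists (b * d ^+ 2 / 32).
    by rewrite divr_gt0// mulr_gt0// exprn_gt0.
  by move=> t /andP[_ /ltW].
have s3 : s * ln 3 <= b * d / 8.
  near: s; apply/near_at_right0P; exists (b * d / 8 / ln 3).
    by rewrite divr_gt0// ln_gt0// ltr1n.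
  by move=> t /andP[_ /ltW]; rewrite ler_pdivlMr// ln_gt0// ltr1n.
move=> P pP.
have P1 : 1 <= P.
  rewrite -p0; apply: pP; apply: divr_ge0; last exact: sqr_ge0.
  by apply: mulr_ge0; [lra|exact: ltW].
have P0 : 0 < P by exact: lt_le_trans P1.
have t10 : 0 < (1 + eta) * s by rewrite mulr_gt0.
have t20 : 0 < (1 - eta) * s by rewrite mulr_gt0.
have es0 : 0 < eta * s by rewrite mulr_gt0.
have st1 : s < (1 + eta) * s by rewrite ltr_pMl// ltrDl.
have t2s : (1 - eta) * s < s by rewrite gtr_pMl// ltrBlDr ltrDl.
have es : eta * s < s by rewrite gtr_pMl// /eta; lra.
have sG1 : (1 + eta) * s < dG by rewrite mulrC -ltr_pdivlMr.
have sG0 : s < dG by exact: lt_trans sG1.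
have sG2 : (1 - eta) * s < dG by exact: lt_trans sG0.
have g0 : 0 < (1 - expR (- (eta * s)))^-1 by rewrite invr_gt0 subr_gt0 expRN_lt1.
have H := laplace_three_ranges ((1 - d) * b / s ^+ 2) st1 t20 t2s es0 es (ltW P0) pP.
have E1 : (1 + eta) * s - s = eta * s by ring.
have E2 : s - (1 - eta) * s = eta * s by ring.
rewrite E1 E2 in H.
exact: (three_ranges_arith b_gt0 d0 d1 s0 sb s3 (F_gt0 s0) (F_gt0 t10) (F_gt0 t20)
  P0 g0 (HG s (introT andP (conj s0 sG0))) (HG _ (introT andP (conj t10 sG1)))
  (HG _ (introT andP (conj t20 sG2))) hgeo H).
Unshelve. all: by end_near. Qed.

Variable n0 : nat.
Hypothesis p_mono : forall n m, (n0 <= m)%N -> p n <= p (n + m)%N.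

(** For the lower bound take [s = (1 + d) sqrt (b / n)] in [near_saddle]: then all
    [k <= (1 + d) b / s^2 = n / (1 + d)] satisfy [k + n0 <= n], hence
    [p k <= p n]. *)
Lemma cvg_growth_of_log_laplace :
  ln (p n) / (2 * Num.sqrt (b * n%:R)) @[n --> \oo] --> (1 : R).
Proof.
apply/cvgrPdist_le => e e0.
pose d := Num.min (1 / 2) (e / 2).
have d0 : 0 < d by rewrite lt_min !divr_gt0.
have d1 : d <= 1 / 2 by rewrite ge_min lexx.
have de : 2 * d <= e.
  have : d <= e / 2 by rewrite ge_min lexx orbT.
  lra.
have be0 : 0 < b * e by rewrite mulr_gt0.
have /near_at_right0P[s1 s10 H1] := near_saddle d0 d1.
have /near_at_right0P[s2 s20 H2] : \forall s \near 0^'+,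
    `|b - s * ln (laplace p s)| <= b * e.
  by move/cvgrPdist_le : log_F; apply.
have scale (c x : R) : 0 < c -> 0 < x ->
    \forall n \near \oo, c * Num.sqrt (b / n%:R) < x.
  move=> c0 x0; near=> n.
  have n_gt : c ^+ 2 * b / x ^+ 2 < n%:R.
    near: n; apply: nbhs_infty_gtr.
  have nn : 0 < n%:R :> R.
    by apply: le_lt_trans n_gt; rewrite divr_ge0 ?sqr_ge0// mulr_ge0 ?sqr_ge0// ltW.
  have -> : c * Num.sqrt (b / n%:R) = Num.sqrt (c ^+ 2 * b / n%:R).
    by rewrite -mulrA (@sqrtrM _ (c ^+ 2)) ?sqr_ge0// sqrtr_sqr gtr0_norm.
  rewrite -[ltRHS](gtr0_norm x0) -sqrtr_sqr ltr_sqrt ?exprn_gt0//.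
  by rewrite ltr_pdivrMr// [ltRHS]mulrC -ltr_pdivrMr ?exprn_gt0.
have dp : 0 < 1 + d by rewrite addr_gt0.
near=> n.
have n_gt0 : (0 < n)%N by near: n; exact: nbhs_infty_gt.
have nR : 0 < n%:R :> R by rewrite ltr0n.
have nn0 : (n0 <= n)%N by near: n; exact: nbhs_infty_ge.
have nd : n0%:R * (1 + d) / d <= n%:R.
  by near: n; exact: nbhs_infty_ger.
have q1 : (1 + d) * Num.sqrt (b / n%:R) < s1 by near: n; exact: scale.
have q2 : 1 * Num.sqrt (b / n%:R) < s2 by near: n; exact: scale.
pose q := Num.sqrt (b / n%:R).
have q0 : 0 < q by rewrite sqrtr_gt0 divr_gt0.
have qq : q ^+ 2 = b / n%:R by rewrite sqr_sqrtr// divr_ge0// ltW.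
pose D := Num.sqrt (b * n%:R).
have D0 : 0 < D by rewrite sqrtr_gt0 mulr_gt0.
have Dq : D * q = b.
  rewrite /D /q -sqrtrM ?mulr_ge0 ?(ltW b_gt0)//.
  have -> : b * n%:R * (b / n%:R) = b ^+ 2 by field; rewrite gt_eqF.
  by rewrite sqrtr_sqr gtr0_norm.
have nq : n%:R * q = D.
  apply: (@mulIf _ q); first by rewrite gt_eqF.
  by rewrite Dq -mulrA -expr2 qq; field; rewrite gt_eqF.
have pn1 : 1 <= p n by rewrite -p0 -[n in leRHS]add0n; exact: p_mono.
have lo : D * (2 - 2 * e) <= ln (p n).
  have s0 : 0 < (1 + d) * q by rewrite mulr_gt0.
  have := H1 _ (introT andP (conj s0 q1)) (p n).
  have -> : (1 + d) * b / ((1 + d) * q) ^+ 2 = n%:R / (1 + d).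
    by rewrite exprMn qq; field; rewrite !gt_eqF.
  move=> H; have h : b * (2 - 2 * d) <= (1 + d) * q * ln (p n).
    apply: H => k kn.
    have kn0 : (k + n0 <= n)%N.
      rewrite -(ler_nat R) natrD.
      have : k%:R * (1 + d) <= n%:R by rewrite -ler_pdivlMr.
      move: nd; rewrite ler_pdivrMr// => h1 h2.
      rewrite -(ler_pM2r dp); lra.
    have kn' : (k <= n)%N by apply: leq_trans kn0; rewrite leq_addr.
    rewrite -[n in leRHS](subnKC kn'); apply: p_mono.
    by rewrite leq_subRL.
  have h' : D * (2 - 2 * d) <= (1 + d) * ln (p n).
    rewrite -(ler_pM2r q0); move: h; rewrite -{1}Dq; lra.
  have lp : 0 <= ln (p n) by exact: ln_ge0.
  have : D * (2 - 2 * e) <= D * (2 - 4 * d) by rewrite ler_pM2l//; lra.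
  have x1 : D * (2 - 2 * d) / (1 + d) <= ln (p n) by rewrite ler_pdivrMr// [leRHS]mulrC.
  have x2 : D * (2 - 4 * d) <= D * (2 - 2 * d) / (1 + d).
    rewrite ler_pdivlMr//.
    have : 0 <= D * d * d by rewrite !mulr_ge0// ltW.
    lra.
  lra.
have hi : ln (p n) <= D * (2 + 2 * e).
  rewrite mul1r -/q in q2.
  have := H2 q (introT andP (conj q0 q2)); rewrite ler_norml => /andP[h _].
  have := ln_term_le p_ge0 p_cvg q0 (lt_le_trans ltr01 pn1); rewrite nq => h2.
  have : ln (laplace p q) <= D * (1 + e).
    rewrite -(ler_pM2l q0); have -> : q * (D * (1 + e)) = b + b * e by rewrite -Dq; ring.
    lra.
  have : 0 <= D * e by rewrite mulr_ge0// ltW.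
  lra.
rewrite -/D; have D2 : 0 < 2 * D by rewrite mulr_gt0.
have -> : 1 - ln (p n) / (2 * D) = (2 * D - ln (p n)) / (2 * D).
  by field; rewrite gt_eqF.
rewrite normrM normfV (gtr0_norm D2) ler_pdivrMr// ler_norml.
by apply/andP; split; lra.
Unshelve. all: by end_near. Qed.

End GrowthFromLaplace.

(** * Densities and growth of partition functions *)

Section Assembly.
Context {R : realType}.

Lemma card_initial_part (A : set nat) N :
  (#|` fset_set [set k | A k /\ (k < N)%N]|%fset)%:R = series (\1_A : nat -> R) N.
Proof.
elim: N => [|N IH].
  rewrite /series/= big_geq// (_ : [set k | _] = set0) ?fset_set0 ?cardfs0//.
  by apply/seteqP; split=> k // [].
have fin : finite_set [set k | A k /\ (k < N)%N].
  by apply: (@sub_finite_set _ _ `I_N); [move=> k []|exact: finite_II].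
rewrite seriesSr -IH indicE; have [/set_mem AN|/negP nAN] := boolP (N \in A).
  rewrite (_ : [set k | A k /\ (k < N.+1)%N] = N |` [set k | A k /\ (k < N)%N]).
    have nN : N \in [set k | A k /\ (k < N)%N] = false.
      by apply/negP => /set_mem[_]; rewrite ltnn.
    by rewrite fset_setU1// cardfsU1 in_fset_set// nN natrD addrC.
  apply/seteqP; split=> k /=.
    by rewrite ltnS leq_eqVlt => -[Ak /predU1P[->|kN]]; [left|right].
  by move=> [->|[Ak kN]]; split=> //; exact: ltnW.
rewrite addr0; congr (#|` fset_set _|%fset)%:R.
apply/seteqP; split=> k /= [Ak kN]; split=> //; last exact: ltnW.
by move: kN; rewrite ltnS leq_eqVlt => /predU1P[kE|//]; case: nAN; rewrite -kE; exact/mem_set.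
Qed.

Lemma has_density_indic (A : set nat) (alpha : R) :
  has_density A alpha <-> counting_density (\1_A : nat -> R) alpha.
Proof.
have near_eq : \forall x \near (+oo%R : set_system R),
    (count_upto A x)%:R / x = series (\1_A : nat -> R) (Num.truncn x).+1 / x.
  near=> x.
  have x0 : 0 <= x by near: x; apply: nbhs_pinfty_ge; exact: num_real.
  congr (_ / _); rewrite -card_initial_part; congr (#|` fset_set _|%fset)%:R.
  by apply/seteqP; split=> k /= []; rewrite ltnS truncn_ge_nat.
split; apply: cvg_trans; apply: near_eq_cvg => //.
by near=> x; apply/esym; near: x.
Unshelve. all: by end_near. Qed.

Lemma asymp_equiv_scale (f : nat -> R) (alpha : R) : 0 < alpha ->
  asymp_equiv f (fun n => c0 R * Num.sqrt (alpha * n%:R)) <->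
  f n / (2 * Num.sqrt (pi ^+ 2 / 6 * alpha * n%:R)) @[n --> \oo] --> (1 : R).
Proof.
move=> a0; rewrite /asymp_equiv.
suff E n : c0 R * Num.sqrt (alpha * n%:R) = 2 * Num.sqrt (pi ^+ 2 / 6 * alpha * n%:R).
  by under eq_fun do rewrite E.
have P0 := @pi_ge0 R.
rewrite /c0 -[X in X * _ * _](ger0_norm P0) -sqrtr_sqr.
have {2}-> : 2 = Num.sqrt (2 ^+ 2) :> R by rewrite sqrtr_sqr ger0_norm.
rewrite -!sqrtrM ?sqr_ge0 ?mulr_ge0 ?sqr_ge0//.
by congr Num.sqrt; field.
Qed.

End Assembly.

Unset Implicit Arguments.

Theorem theorem8 (R : realType) (A : set nat) (alpha : R) :
  (forall k : nat, A k -> (0 < k)%N) ->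
  is_gcd A 1 ->
  0 < alpha ->
  has_density A alpha <->
  asymp_equiv (fun n : nat => ln (partition_count A n)%:R)
              (fun n : nat => c0 R * Num.sqrt (alpha * n%:R)).
Proof.
move=> A0 gA a0.
pose p n : R := (partition_count A n)%:R.
have b0 : 0 < pi ^+ 2 / 6 * alpha by rewrite mulr_gt0// divr_gt0// exprn_gt0// pi_gt0.
have u0 := @indic_parts0 R A A0; have ug := @indic_ge0 R A; have ul := @indic_le1 R A.
have p_ge0 n : 0 <= p n by [].
have p_cvg s : 0 < s -> cvgn (series (fun n => p n * expR (- s) ^+ n)).
  by move=> s0; case: (log_gf A0 s0).
have logE : \forall s \near (0 : R)^'+, s * ln (laplace p s) = log_mean (\1_A : nat -> R) s.
  near=> s; have s0 : 0 < s by near: s; exact: near_at_right0_gt0.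
  by case: (log_gf A0 s0).
rewrite has_density_indic asymp_equiv_scale//; split=> [dA|growth].
- have G : s * ln (laplace p s) @[s --> 0^'+] --> pi ^+ 2 / 6 * alpha.
    have gA' := cvg_log_mean_of_mean u0 ug ul (cvg_mean_of_density ug ul dA).
    apply: cvg_trans gA'; apply: near_eq_cvg.
    by near=> s; apply/esym; near: s.
  have [N HN] := partition_count_eventually_gt0 A0 gA.
  apply: (@cvg_growth_of_log_laplace _ p _ p_ge0 _ p_cvg b0 G N) => [|n m Nm].
    by rewrite /p partition_count0.
  by rewrite ler_nat partition_count_leD// HN.
- apply: density_of_cvg_mean => //; apply: cvg_mean_of_log_mean => //.
  have G : s * ln (laplace p s) @[s --> 0^'+] --> pi ^+ 2 / 6 * alpha.
    apply: cvg_log_laplace_of_growth => // n.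
    rewrite /p; case: (partition_count A n) => [|m]; first by left.
    by right; rewrite ler1n.
  by apply: cvg_trans G; exact: near_eq_cvg.
Unshelve. all: by end_near. Qed.
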